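(* Let $0<\alpha<2$ and $0<\beta<2$, and let $\mu$ be a finite positive Borel measure on $[0,1)$. Then the following statements are equivalent: (1) $\mathcal{C}_{\mu}: \mathcal{D}_{\alpha}\rightarrow \mathcal{D}_{\beta}$ is compact. (2) $\mu$ is a vanishing $[1+\frac{1}{2}(\alpha-\beta)]$-Carleson measure on $[0, 1)$. (3) $$\mu[n]=o\left((n+1)^{-1-\frac{1}{2}(\alpha-\beta)}\right), \quad n\rightarrow \infty.$$
   Context: $\mathbb{N}_0=\mathbb{N}\cup\{0\}$, $\mathbb{D}$ is the open unit disk in $\mathbb{C}$ and $\mathcal{H}(\mathbb{D})$ is the class of all analytic functions on $\mathbb{D}$. For $\alpha\in\mathbb{R}$, the Dirichlet-type space is $$\mathcal{D}_{\alpha}=\Big\{f=\sum_{n=0}^{\infty}a_nz^n\in \mathcal{H}(\mathbb{D}): \|f\|_{\mathcal{D}_{\alpha}}:=\Big(\sum_{n=0}^{\infty}(n+1)^{1-\alpha} |a_{n}|^2\Big)^{1/2}<\infty\Big\}.$$ For a positive Borel measure $\mu$ on $[0,1)$ put $\mu[n]=\int_{0}^1 t^{n}\,d\mu(t)$ for $n\in \mathbb{N}_{0}$. The generalized Cesàro operator $\mathcal{C}_{\mu}$ is defined, for $f=\sum_{n=0}^{\infty}a_n z^n \in \mathcal{H}(\mathbb{D})$, by $$\mathcal{C}_{\mu}(f)(z)=\sum_{n=0}^\infty \Big(\mu[n]\sum_{k=0}^n a_k\Big)z^n,\quad z\in \mathbb{D}.$$ That $\mathcal{C}_{\mu}: \mathcal{D}_{\alpha}\rightarrow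 \mathcal{D}_{\beta}$ is compact means that $\mathcal{C}_\mu$ maps $\mathcal{D}_\alpha$ into $\mathcal{D}_\beta$ and is a compact linear operator between these normed spaces. For $s>0$, a positive Borel measure $\mu$ on $[0,1)$ is an $s$-Carleson measure if there is a constant $C>0$ such that $\mu([t, 1))\leq C (1-t)^s$ for all $t\in [0, 1)$. It is a vanishing $s$-Carleson measure if it is an $s$-Carleson measure and $$\lim_{t\rightarrow 1^{-}}\frac{\mu([t, 1))}{(1-t)^s}=0.$$ *)

(* Defs.v *)
From HB Require Import structures.
From mathcomp Require Import all_boot all_order all_algebra.
From mathcomp Require Import complex ring lra.
From mathcomp Require Import all_classical all_reals all_analysis.

Set Implicit Arguments.
Unset Strict Implicit.
Unset Printing Implicit Defensive.

Import Order.TTheory GRing.Theory Num.Theory.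
Import numFieldNormedType.Exports.

Local Open Scope classical_set_scope.
Local Open Scope complex_scope.
Local Open Scope ring_scope.

Lemma power_series0 (K : numFieldType) (a : nat -> K) :
  (forall z : K, `|z| < 1 -> series (fun n => a n * z ^+ n) @ \oo --> (0 : K)) ->
  forall n, a n = 0.
Proof.
move=> a0; elim/ltn_ind => N IH.
have half1 : `|2^-1 : K| < 1.
  by rewrite ger0_norm ?invr_ge0 ?ler0n// invf_lt1 ?ltr1n ?ltr0n.
have /cvgP/cvg_series_cvg_0/cvgP/cvg_seq_bounded := a0 _ half1.
move=> /pinfty_ex_gt0[M M0 aM].
have {}aM n : `|a n| <= M * 2 ^+ n.
  have := aM n I; rewrite /= normrM normrX (ger0_norm (_ : 0 <= 2^-1)).
    by rewrite exprVn ler_pdivrMr// exprn_gt0.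
  by rewrite invr_ge0 ler0n.
have key (z : K) : 0 < z -> z <= 4^-1 -> `|a N| <= M * 2 ^+ N.+2 * z.
  move=> z0 z4.
  have nz : `|z| = z by rewrite gtr0_norm.
  have z1 : `|z| < 1.
    by rewrite nz (le_lt_trans z4)// invf_lt1 ?ltr1n ?ltr0n.
  have /cvgrPdist_lt h := a0 _ z1.
  rewrite -(ler_pM2r (exprn_gt0 N z0)).
  apply/ler_addgt0Pr => e e0.
  have [m _ /(_ (m + N.+1)%N)] := h _ e0.
  rewrite /= leq_addr sub0r normrN => /(_ isT) /ltW Sm.
  rewrite -{1}nz -normrX -normrM.
  have -> : a N * z ^+ N = series (fun n => a n * z ^+ n) (m + N.+1)%N
      - \sum_(i < m) a (N.+1 + i)%N * z ^+ (N.+1 + i).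
    rewrite /series /= addnC big_mkord big_split_ord /= addrK.
    rewrite big_ord_recr /= big1 ?add0r// => i _.
    by rewrite IH ?mul0r// ltn_ord.
  rewrite (le_trans (ler_normB _ _))// addrC lerD//.
  have le1 (i : nat) : `|a (N.+1 + i)%N * z ^+ (N.+1 + i)| <=
     M * 2 ^+ N.+1 * z ^+ N.+1 * 2^-1 ^+ i.
    rewrite normrM normrX nz.
    apply: le_trans (_ : M * 2 ^+ (N.+1 + i) * z ^+ (N.+1 + i) <= _).
      by rewrite ler_wpM2r// exprn_ge0// ltW.
    have -> : M * 2 ^+ (N.+1 + i) * z ^+ (N.+1 + i) =
              M * 2 ^+ N.+1 * z ^+ N.+1 * (2 * z) ^+ i.
      by rewrite exprMn !exprD; ring.
    rewrite ler_wpM2l ?mulr_ge0 ?exprn_ge0 ?ler0n ?(ltW z0) ?(ltW M0)//.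
    rewrite lerXn2r ?nnegrE ?mulr_ge0 ?invr_ge0 ?ler0n ?(ltW z0)//.
    rewrite (le_trans (ler_wpM2l _ z4)) ?ler0n//.
    by rewrite (natrM _ 2 2) invfM mulrA divff ?mul1r ?pnatr_eq0.
  apply: le_trans (ler_norm_sum _ _ _) _.
  apply: le_trans (ler_sum _ (fun (i : 'I_m) _ => le1 i)) _.
  rewrite -mulr_sumr.
  have -> : M * 2 ^+ N.+2 * z * z ^+ N = M * 2 ^+ N.+1 * z ^+ N.+1 * 2.
    by rewrite !exprS; ring.
  rewrite ler_wpM2l ?mulr_ge0 ?exprn_ge0 ?ler0n ?(ltW z0) ?(ltW M0)//.
  have -> : \sum_(i < m) (2^-1 : K) ^+ i = 2 - 2 * 2^-1 ^+ m.
    elim: m {Sm} => [|m IHm]; first by rewrite big_ord0 expr0 mulr1 subrr.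
    by rewrite big_ord_recr /= IHm exprS; field.
  by rewrite lerBlDr lerDl mulr_ge0 ?exprn_ge0 ?invr_ge0 ?ler0n.
set B := M * 2 ^+ N.+2 in key.
have B0 : 0 < B by rewrite mulr_gt0 ?exprn_gt0 ?ltr0n.
apply/eqP; rewrite -normr_le0; apply/ler_addgt0Pr => e e0; rewrite add0r.
have D0 : 0 < B + 4 * e by rewrite addr_gt0// mulr_gt0// ltr0n.
apply: le_trans (key (e / (B + 4 * e)) _ _) _.
- by rewrite divr_gt0.
- rewrite ler_pdivrMr// -ler_pdivrMl ?invr_gt0 ?ltr0n// invrK.
  by rewrite lerDr ltW.
- by rewrite mulrA ler_pdivrMr// mulrC ler_pM2l// lerDl mulr_ge0 ?ler0n ?ltW.
Qed.

Lemma le_add_sqr (R : realType) (x y z : R) : 0 <= x -> 0 <= y -> 0 <= z ->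
  (forall t, 0 < t -> z ^+ 2 <= (1 + t) * x ^+ 2 + (1 + t^-1) * y ^+ 2) ->
  z <= x + y.
Proof.
move=> x0 y0 z0 key.
apply/ler_addgt0Pr => e e0; set d := e / 2.
have d0 : 0 < d by rewrite divr_gt0.
have xd : 0 < x + d by rewrite ltr_wpDl.
have yd : 0 < y + d by rewrite ltr_wpDl.
rewrite -(@ler_pXn2r _ 2) ?nnegrE//; last first.
  by rewrite ?addr_ge0// ltW.
apply: le_trans (key ((y + d) / (x + d)) _) _; first by rewrite divr_gt0.
have -> : (x + y + e) ^+ 2 = (1 + (y + d) / (x + d)) * (x + d) ^+ 2 +
   (1 + ((y + d) / (x + d))^-1) * (y + d) ^+ 2.
  by rewrite (_ : e = d + d); [field; rewrite !gt_eqF|rewrite /d; field].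
rewrite lerD// ler_wpM2l ?addr_ge0 ?invr_ge0 ?divr_ge0 ?(ltW xd) ?(ltW yd)//.
  by rewrite lerXn2r ?nnegrE ?(ltW xd)// lerDl ltW.
by rewrite lerXn2r ?nnegrE ?(ltW yd)// lerDl ltW.
Qed.

Definition compact_operator (K : numFieldType) (V W : normedModType K)
    (T : {linear V -> W}) : Prop :=
  compact (closure (T @` [set x : V | `|x| <= 1])).

(* The library puts the topology and the norm of the complex field [R[i]] on
   the regular algebra [R[i]^o], not on [R[i]] itself. *)
Section dirichlet_space.
Variable R : realType.
Local Notation C := (R[i]^o).
Local Notation normc := ComplexField.Normc.normc.
Implicit Types (alpha : R) (f g : C -> C) (a b : nat -> C).

Definition unit_disk : set C := [set z | `|z| < 1].

(* A function on the disk is represented by its extension by 0 to the plane,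
   so that equality of functions on the disk is Leibniz equality. *)
Definition analytic_disk f : Prop :=
  (forall z, unit_disk z -> derivable f z 1) /\
  (forall z, ~ unit_disk z -> f z = 0).

Definition power_series a (z : C) : nat -> C := series (fun n => a n * z ^+ n).

Definition power_series_expansion f a : Prop :=
  forall z, unit_disk z -> power_series a z @ \oo --> f z.

(* [power_series_expansion_inj] shows that there is at most one candidate. *)
Definition taylor_coef f : nat -> C :=
  xget (fun=> 0) [set a | power_series_expansion f a].

Lemma power_series_expansionD k f g a b :
  power_series_expansion f a -> power_series_expansion g b ->
  power_series_expansion (k *: f + g) (k *: a + b).
Proof.
move=> fa gb z z1; rewrite /power_series.
have -> : (fun n => (k *: a + b) n * z ^+ n) =
    k *: (fun n => a n * z ^+ n) + (fun n => b n * z ^+ n).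
  by apply/funext => n; rewrite /= mulrDl -scalerAl.
rewrite seriesD seriesZ; apply: cvgD; last exact: gb.
by apply: cvgZr; exact: fa.
Qed.

Lemma power_series_expansion_inj f a b :
  power_series_expansion f a -> power_series_expansion f b -> a = b.
Proof.
move=> fa fb; apply/funext => n; apply/eqP; rewrite -subr_eq0; apply/eqP.
suff /power_series0 : forall z : C, `|z| < 1 ->
  series (fun n => (- 1 *: b + a) n * z ^+ n) @ \oo --> (0 : C).
  by move=> /(_ n) <- /=; rewrite scaleN1r addrC.
move=> z z1.
have := power_series_expansionD (k := -1) fb fa z1.
by rewrite [- 1 *: f]scaleN1r [- f + f]addNr.
Qed.

Lemma taylor_coefE f a : power_series_expansion f a -> taylor_coef f = a.
Proof.
move=> fa; rewrite /taylor_coef.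
by case: xgetP => [b _ /power_series_expansion_inj|/(_ a)//]; exact.
Qed.

Definition dirichlet_sum alpha a : \bar R :=
  (\sum_(0 <= n <oo) (n.+1%:R `^ (1 - alpha) * normc (a n) ^+ 2)%:E)%E.

Definition dirichlet_pred alpha : {pred C -> C} :=
  [pred f | `[< analytic_disk f /\
     exists2 a, power_series_expansion f a & (dirichlet_sum alpha a < +oo)%E >]].

Lemma dirichlet_predP alpha f :
  reflect (analytic_disk f /\
     exists2 a, power_series_expansion f a & (dirichlet_sum alpha a < +oo)%E)
    (f \in dirichlet_pred alpha).
Proof. exact: asboolP. Qed.

Lemma dirichlet_sum_ge0 alpha a : (0 <= dirichlet_sum alpha a)%E.
Proof.
by apply: nneseries_ge0 => n _ _; rewrite lee_fin mulr_ge0 ?powR_ge0 ?sqr_ge0.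
Qed.

Lemma dirichlet_sumZ alpha k a :
  dirichlet_sum alpha (k *: a)%R = ((normc k ^+ 2)%:E * dirichlet_sum alpha a)%E.
Proof.
rewrite /dirichlet_sum -nneseriesZl; last first.
  by move=> n _; rewrite lee_fin mulr_ge0 ?powR_ge0 ?sqr_ge0.
apply: eq_eseriesr => n _.
by rewrite -EFinM ComplexField.Normc.normcM exprMn mulrCA.
Qed.

Lemma le_normcD_sqr (t : R) (x y : C) : 0 < t ->
  normc (x + y) ^+ 2 <= (1 + t) * normc x ^+ 2 + (1 + t^-1) * normc y ^+ 2.
Proof.
move=> t0.
have n0 (z : C) : 0 <= normc z by case: z => u v; exact: sqrtr_ge0.
apply: (@le_trans _ _ ((normc x + normc y) ^+ 2)).
  by rewrite lerXn2r ?nnegrE ?addr_ge0// le_normcD.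
rewrite -subr_ge0 [leRHS](_ : _ = t^-1 * (t * normc x - normc y) ^+ 2).
  by rewrite mulr_ge0 ?sqr_ge0// invr_ge0 ltW.
by field; rewrite gt_eqF.
Qed.

Lemma dirichlet_sumD_le alpha (t : R) a b : 0 < t ->
  (dirichlet_sum alpha (a + b)%R <= (1 + t)%:E * dirichlet_sum alpha a +
                                 (1 + t^-1)%:E * dirichlet_sum alpha b)%E.
Proof.
move=> t0.
have w0 (c : nat -> C) n :
    (0 <= (n.+1%:R `^ (1 - alpha) * normc (c n) ^+ 2)%:E)%E.
  by rewrite lee_fin mulr_ge0 ?powR_ge0 ?sqr_ge0.
have u0 : 0 <= 1 + t by rewrite addr_ge0// ltW.
have v0 : 0 <= 1 + t^-1 by rewrite addr_ge0// invr_ge0 ltW.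
rewrite /dirichlet_sum -!nneseriesZl// -nneseriesD; last 2 first.
- by move=> n _ _; rewrite mule_ge0// lee_fin.
- by move=> n _ _; rewrite mule_ge0// lee_fin.
apply: lee_nneseries => // n _.
rewrite -!EFinM -EFinD lee_fin.
rewrite [leRHS](_ : _ = n.+1%:R `^ (1 - alpha) *
  ((1 + t) * normc (a n) ^+ 2 + (1 + t^-1) * normc (b n) ^+ 2)); last by ring.
by rewrite ler_wpM2l ?powR_ge0// le_normcD_sqr.
Qed.

Lemma dirichlet_sum_le0 alpha a :
  (dirichlet_sum alpha a <= 0)%E -> forall n, a n = 0.
Proof.
move=> a0 n; pose w m := (m.+1%:R `^ (1 - alpha) * normc (a m) ^+ 2)%:E.
have w0 m : (0 <= w m)%E by rewrite lee_fin mulr_ge0 ?powR_ge0 ?sqr_ge0.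
have : (w n <= 0)%E.
  apply: le_trans (le_trans _ a0); last first.
    exact: (nneseries_lim_ge n.+1 (fun m _ _ => w0 m)).
  by rewrite big_mkord big_ord_recr /=; apply: leeDr; exact: sume_ge0.
rewrite lee_fin pmulr_rle0 ?powR_gt0// => h.
apply: ComplexField.Normc.eq0_normc; apply/eqP.
by rewrite -sqrf_eq0 eq_le h sqr_ge0.
Qed.

Lemma dirichlet_submod_closed alpha : submod_closed (dirichlet_pred alpha).
Proof.
split.
  apply/dirichlet_predP; split.
    by split=> // z _; exact: derivable_cst.
  exists (fun=> 0).
    move=> z _; rewrite /power_series.
    rewrite (_ : (fun n => 0 * z ^+ n) = fun=> 0); last first.
      by apply/funext => n; rewrite mul0r.
    rewrite (_ : series _ = cst 0); first exact: cvg_cst.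
    by apply/funext => n; rewrite /series /= big1.
  rewrite /dirichlet_sum eseries0 ?ltry// => n _ _.
  by rewrite ComplexField.Normc.normc0 expr0n mulr0.
move=> k f g /dirichlet_predP[[df f0] [a fa aoo]].
move=> /dirichlet_predP[[dg g0] [b gb boo]]; apply/dirichlet_predP; split.
  split=> z z1.
    by apply: derivableD; [apply: derivableZ; exact: df|exact: dg].
  by change (k *: f z + g z = 0); rewrite f0// g0// scaler0 addr0.
exists (k *: a + b); first exact: power_series_expansionD.
apply: le_lt_trans (dirichlet_sumD_le _ _ _ ltr01) _.
have s1 : 0 <= 1 + 1 :> R by [].
rewrite invr1 lte_add_pinfty// lte_mul_pinfty ?lee_fin ?dirichlet_sum_ge0//.
by rewrite dirichlet_sumZ lte_mul_pinfty ?lee_fin ?sqr_ge0.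
Qed.

HB.instance Definition _ alpha := GRing.isSubmodClosed.Build _ _
  (dirichlet_pred alpha) (dirichlet_submod_closed alpha).

Record dirichlet alpha : Type := Dirichlet {
  dirichlet_fun :> C -> C;
  dirichlet_funP : dirichlet_fun \in dirichlet_pred alpha }.

HB.instance Definition _ alpha := [isSub for @dirichlet_fun alpha].
HB.instance Definition _ alpha := [Choice of dirichlet alpha by <:].
HB.instance Definition _ alpha :=
  [SubChoice_isSubLmodule of dirichlet alpha by <:].

Lemma dirichlet_taylorP alpha (f : dirichlet alpha) :
  power_series_expansion f (taylor_coef f).
Proof.
have /dirichlet_predP[_ [a fa _]] := dirichlet_funP f.
by rewrite (taylor_coefE fa).
Qed.

Lemma dirichlet_sum_lty alpha (f : dirichlet alpha) :
  (dirichlet_sum alpha (taylor_coef f) < +oo)%E.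
Proof.
have /dirichlet_predP[_ [a fa aoo]] := dirichlet_funP f.
by rewrite (taylor_coefE fa).
Qed.

Lemma dirichlet_sum_fin_num alpha (f : dirichlet alpha) :
  dirichlet_sum alpha (taylor_coef f) \is a fin_num.
Proof. by rewrite ge0_fin_numE ?dirichlet_sum_ge0// dirichlet_sum_lty. Qed.

Lemma dirichlet_taylorD alpha k (f g : dirichlet alpha) :
  taylor_coef (k *: f + g) = k *: taylor_coef f + taylor_coef g.
Proof.
by apply: taylor_coefE; apply: power_series_expansionD; exact: dirichlet_taylorP.
Qed.

Definition dirichlet_norm alpha (f : dirichlet alpha) : R :=
  Num.sqrt (fine (dirichlet_sum alpha (taylor_coef f))).

Lemma dirichlet_normZ alpha k (f : dirichlet alpha) :
  dirichlet_norm (k *: f) = normc k * dirichlet_norm f.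
Proof.
rewrite /dirichlet_norm.
have := dirichlet_taylorD k f 0; rewrite addr0 => ->.
have -> : taylor_coef (0 : dirichlet alpha) = 0.
  by have := dirichlet_taylorD (-1) f f; rewrite !scaleN1r !addNr.
rewrite addr0 dirichlet_sumZ fineM ?dirichlet_sum_fin_num//=.
rewrite sqrtrM ?sqr_ge0// sqrtr_sqr ger0_norm//.
by case: k => u v; exact: sqrtr_ge0.
Qed.

Lemma dirichlet_normD alpha (f g : dirichlet alpha) :
  dirichlet_norm (f + g) <= dirichlet_norm f + dirichlet_norm g.
Proof.
set x := dirichlet_norm f; set y := dirichlet_norm g.
have x0 : 0 <= x by exact: sqrtr_ge0.
have y0 : 0 <= y by exact: sqrtr_ge0.
have n2 (h : dirichlet alpha) :
    dirichlet_sum alpha (taylor_coef h) = (dirichlet_norm h ^+ 2)%:E.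
  by rewrite sqr_sqrtr ?fineK ?dirichlet_sum_fin_num// fine_ge0// dirichlet_sum_ge0.
have key (t : R) : 0 < t ->
    dirichlet_norm (f + g) ^+ 2 <= (1 + t) * x ^+ 2 + (1 + t^-1) * y ^+ 2.
  move=> t0.
  have aux (p q r : \bar R) (u v w : R) : p = (u ^+ 2)%:E -> q = (v ^+ 2)%:E ->
      r = (w ^+ 2)%:E -> (p <= (1 + t)%:E * q + (1 + t^-1)%:E * r)%E ->
      u ^+ 2 <= (1 + t) * v ^+ 2 + (1 + t^-1) * w ^+ 2.
    by move=> -> -> ->; rewrite -!EFinM -EFinD lee_fin.
  apply: (aux _ _ _ _ _ _ (n2 (f + g)) (n2 f) (n2 g)).
  have := dirichlet_taylorD 1 f g; rewrite !scale1r => ->.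
  exact: dirichlet_sumD_le.
by apply: le_add_sqr key; exact: sqrtr_ge0.
Qed.

Lemma dirichlet_norm0_eq0 alpha (f : dirichlet alpha) :
  dirichlet_norm f = 0 -> f = 0.
Proof.
move=> /eqP; rewrite sqrtr_eq0 => f0.
have {}f0 : (dirichlet_sum alpha (taylor_coef f) <= 0)%E.
  by rewrite -(fineK (dirichlet_sum_fin_num f)) lee_fin.
have a0 n := dirichlet_sum_le0 f0 n.
apply: val_inj; apply/funext => z /=.
have [[_ f0'] _] := dirichlet_predP _ _ (dirichlet_funP f).
have [z1|/f0'//] := pselect (unit_disk z).
have fz0 : power_series (taylor_coef f) z = cst 0.
  apply/funext => n; rewrite /power_series /series /= big1// => i _.
  by rewrite a0 mul0r.
have fz := @dirichlet_taylorP _ f _ z1; rewrite fz0 in fz.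
by have := cvg_lim (@norm_hausdorff _ C) fz; rewrite lim_cst// => <-.
Qed.

Let dirichlet_normC alpha (f : dirichlet alpha) : R[i] := (dirichlet_norm f)%:C.

Let dirichlet_normCD alpha (f g : dirichlet alpha) :
  dirichlet_normC (f + g) <= dirichlet_normC f + dirichlet_normC g.
Proof. by rewrite -rmorphD lecR dirichlet_normD. Qed.

Let dirichlet_normCZ alpha (k : R[i]) (f : dirichlet alpha) :
  dirichlet_normC (k *: f) = `|k| * dirichlet_normC f.
Proof. by rewrite /dirichlet_normC dirichlet_normZ rmorphM. Qed.

Let dirichlet_normC0_eq0 alpha (f : dirichlet alpha) :
  dirichlet_normC f = 0 -> f = 0.
Proof. by move=> [] /dirichlet_norm0_eq0. Qed.

(* The norm of a normed module over [R[i]] takes its values in [R[i]]. *)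
HB.instance Definition _ alpha := Lmodule_isNormed.Build R[i] (dirichlet alpha)
  (@dirichlet_normCD alpha) (@dirichlet_normCZ alpha)
  (@dirichlet_normC0_eq0 alpha).

Lemma dirichlet_normE alpha (f : dirichlet alpha) :
  `|f| = (dirichlet_norm f)%:C.
Proof. by []. Qed.

End dirichlet_space.

Section cesaro.
Variable R : realType.
Variable mu : {measure set (measurableTypeR R) -> \bar R}.
Local Notation C := (R[i]^o).

Definition moment (n : nat) : R := \int[mu]_(t in `[0%R, 1%R[) (t ^+ n).

Definition cesaro_coef (a : nat -> C) (n : nat) : C :=
  (moment n)%:C * \sum_(k < n.+1) a k.

Definition cesaro (f : C -> C) (z : C) : C :=
  if z \in @unit_disk R then limn (power_series (cesaro_coef (taylor_coef f)) z)
  else 0.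

(* The linear operator [T] witnesses that [cesaro] maps the first space into the
   second one, and compactness is for their norm topologies. *)
Definition cesaro_compact (alpha beta : R) : Prop :=
  exists2 T : {linear dirichlet alpha -> dirichlet beta},
    (forall f, T f = cesaro f :> (C -> C)) & compact_operator T.

Definition carleson (s : R) : Prop :=
  exists2 c : R, 0 < c & forall t : R, 0 <= t < 1 ->
    (mu `[t, 1%R[%classic <= (c * (1 - t) `^ s)%:E)%E.

(* [fine] is harmless here: the first clause makes the measures finite. *)
Definition vanishing_carleson (s : R) : Prop :=
  carleson s /\
  fine (mu `[t, 1[%classic) / (1 - t) `^ s @[t --> (1 : R)^'-] --> (0 : R).

End cesaro.

(* Main.v *)
(* Write [s = 1 + (alpha - beta) / 2].

   (1) => (2). The truncated geometric series [f_N = q_N (1 + z + .. + z ^+ N)],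
   normalized in [D_alpha], tend to 0 coefficientwise, and so do their images;
   since these lie in a compact set, [|C_mu f_N| --> 0]. The coefficients of
   [C_mu f_N] of index between [N + 1] and [2 (N + 1)] alone give
   [|C_mu f_N| >= c (N + 1) `^ s mu[2 (N + 1)]], and
   [t ^+ n * mu [t, 1) <= mu[n]] with [n] of order [1 / (1 - t)] concludes.

   (2) => (3). Cutting [0, 1) into the shells [k <= n (1 - t) <= k + 1], on which
   [t ^+ n <= 2 ^- k], bounds [mu[n]] by [\sum_k 2 ^- k * mu [1 - (k + 1) / n, 1)].

   (3) => (1). By the weighted Hardy inequality
   [\sum_n (n + 1) `^ (- 1 - alpha) (\sum_(k <= n) a_k) ^+ 2 <=
   c \sum_n (n + 1) `^ (1 - alpha) a_n ^+ 2] the image of the unit ball is bounded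
   and has uniformly small tails in [D_beta]; a set of power series with these two
   properties is compact, because along an ultrafilter all coefficients converge. *)
Require Import Defs.
From HB Require Import structures.
From mathcomp Require Import all_boot all_order all_algebra.
From mathcomp Require Import complex ring lra.
From mathcomp Require Import all_classical all_reals all_analysis.
From mathcomp Require Import measurable_realfun.
Import Order.TTheory GRing.Theory Num.Theory.
Import numFieldNormedType.Exports.
Local Open Scope classical_set_scope.
Local Open Scope ring_scope.

(** * Power sums and the weighted Hardy inequality *)

Section real_inequalities.
Context {R : realType}.
Implicit Types (p x : R) (a u : nat -> R).

(** Follows from exp y >= 1 + y and - ln (1 - 1 / (x + 1)) >= 1 / (x + 1). This lower bound on the
    increments of a power drives the inductions of the next two lemmas. *)
Lemma powR_succ_ge p x : 0 <= p -> 0 < x ->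
  x `^ p * (1 + p / (x + 1)) <= (x + 1) `^ p.
Proof.
move=> p0 x0; have x10 : 0 < x + 1 by rewrite addr_gt0.
have y0 : 0 < (x + 1) / x by rewrite divr_gt0.
have {2}-> : x + 1 = x * ((x + 1) / x) by field; rewrite gt_eqF.
rewrite powRM ?(ltW x0) ?(ltW y0)// ler_wpM2l ?powR_ge0//.
rewrite /powR gt_eqF//; apply: le_trans (expR_ge1Dx _).
rewrite lerD2l ler_wpM2l// -[(x + 1) / x]invrK lnV ?posrE ?invr_gt0//.
have -> : ((x + 1) / x)^-1 = 1 + - (x + 1)^-1.
  by field; rewrite !gt_eqF.
rewrite lerNr; apply: le_ln1Dx.
by rewrite ltrNr opprK invf_lt1// ltrDr.
Qed.

(** By [powR_succ_ge] the increments of the right side dominate the new term. In the constant, 2^p /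
    p absorbs n + 2 <= 2 (n + 1), and the summand 1 covers the first term. *)
Lemma sum_powR_le p : 0 < p -> exists2 c : R, 0 < c &
  forall n, \sum_(k < n) k.+1%:R `^ (p - 1) <= c * n%:R `^ p.
Proof.
move=> p0; exists (2 `^ p / p + 1).
  by rewrite addr_gt0// divr_gt0// powR_gt0.
have c0 : 0 <= 2 `^ p / p by rewrite divr_ge0 ?powR_ge0// ltW.
elim=> [|n IH].
  by rewrite big_ord0 mulr_ge0 ?powR_ge0// addr_ge0.
rewrite big_ord_recr /=; case: n IH => [_|n IH].
  by rewrite big_ord0 add0r !powR1 mulr1 lerDr.
apply: le_trans (lerD IH (lexx _)) _.
have := @powR_succ_ge p n.+1%:R (ltW p0) (ltr0Sn _ _).
rewrite -(natrD _ n.+1 1) addn1 => h.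
rewrite -lerBrDl -mulrBr.
apply: (@le_trans _ _ (2 `^ p / p * (n.+1%:R `^ p * (p / n.+2%:R)))).
  have -> : 2 `^ p / p * (n.+1%:R `^ p * (p / n.+2%:R)) =
      (2 * n.+1%:R) `^ p / n.+2%:R.
    by rewrite powRM//; field; rewrite gt_eqF//= gt_eqF.
  rewrite (ler_pdivlMr _ _ (ltr0Sn R n.+1)) mulrC (mulr_powRB1 (ler0n R _) p0).
  rewrite ge0_ler_powR// ?nnegrE ?(ltW p0)// -natrM ler_nat.
  by rewrite mul2n -addnn addnS addSn !ltnS leq_addl.
rewrite mulrDl mul1r ler_wpDr//.
  rewrite subr_ge0 ge0_ler_powR// ?nnegrE ?(ltW p0)//.
  by rewrite ler_nat.
rewrite ler_wpM2l// lerBrDl; apply: le_trans h.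
by rewrite mulrDr mulr1.
Qed.

Lemma sum_powR_tail_le p (k m : nat) : 0 < p ->
  \sum_(k <= n < m) n.+1%:R `^ (- 1 - p) <= (1 + p^-1) * k.+1%:R `^ (- p).
Proof.
move=> p0.
have c0 : 0 <= p^-1 * k.+1%:R `^ (- p) by rewrite mulr_ge0 ?powR_ge0// invr_ge0 ltW.
have r0 : 0 <= (1 + p^-1) * k.+1%:R `^ (- p).
  by rewrite mulr_ge0 ?powR_ge0// addr_ge0// invr_ge0 ltW.
case: (leqP m k) => [mk|]; first by rewrite big_geq.
(* With p^-1 m^(-p) added, the left side does not increase with m, by [powR_succ_ge], so the
   induction closes. *)
move=> km; suff : \sum_(k <= n < m) n.+1%:R `^ (- 1 - p) + p^-1 * m%:R `^ (- p)
    <= (1 + p^-1) * k.+1%:R `^ (- p).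
  apply: le_trans; rewrite lerDl mulr_ge0 ?powR_ge0//.
  by rewrite invr_ge0 ltW.
elim: m km => // m IH; rewrite ltnS leq_eqVlt => /predU1P[<-|km].
  rewrite big_nat1 mulrDl mul1r lerD2r.
  by rewrite ler_powR ?ler1n// lerBlDr addNr lerN10.
rewrite big_nat_recr ?(ltnW km)//=; apply: le_trans (IH km).
rewrite -addrA lerD2l.
have m0 : 0 < m%:R :> R by rewrite ltr0n (leq_trans _ km).
have := @powR_succ_ge p m%:R (ltW p0) m0.
rewrite -(natrD _ m 1) addn1 => h.
rewrite powRD ?pnatr_eq0 ?implybT// powR_inv1// !powRN.
have m1 : 0 < m.+1%:R `^ p :> R by rewrite powR_gt0.
have m2 : 0 < m%:R `^ p :> R by rewrite powR_gt0.
rewrite -(ler_pM2r m1) -(ler_pM2r m2).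
rewrite [leRHS](_ : _ = p^-1 * m.+1%:R `^ p); last by field; rewrite !gt_eqF.
rewrite [leLHS](_ : _ = p^-1 * (m%:R `^ p * (1 + p / m.+1%:R))).
  by rewrite ler_wpM2l// invr_ge0 ltW.
by field; rewrite !gt_eqF ?pnatr_eq0//= -natr1 addr_gt0.
Qed.

(** Expand the nonnegative weighted variance of [a k / u k] about its mean [A / U]. *)
Lemma cauchy_schwarz_sum n (a u : 'I_n.+1 -> R) : (forall k, 0 < u k) ->
  (\sum_k a k) ^+ 2 <= (\sum_k u k) * (\sum_k (a k) ^+ 2 / u k).
Proof.
move=> u0; set A := \sum_k a k; set U := \sum_k u k.
have U0 : 0 < U by rewrite /U big_ord_recl ltr_wpDr// sumr_ge0// => i _; exact: ltW.
have : 0 <= \sum_k u k * (a k / u k - A / U) ^+ 2.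
  by apply: sumr_ge0 => k _; rewrite mulr_ge0 ?sqr_ge0// ltW.
rewrite (eq_bigr (fun k => (a k) ^+ 2 / u k - 2 * (A / U) * a k
    + (A / U) ^+ 2 * u k)); last by move=> k _; field; rewrite !gt_eqF.
rewrite !big_split /= sumrN -!mulr_sumr -/A -/U.
move=> h; rewrite mulrC -ler_pdivrMr// -subr_ge0; apply: le_trans h _.
by rewrite le_eqVlt; apply/orP; left; apply/eqP; field; rewrite gt_eqF.
Qed.

(* Cauchy-Schwarz with the weights [(k + 1) `^ (alpha / 2 - 1)], then exchange
   of the two summations. *)
Lemma hardy_sum (alpha : R) : 0 < alpha -> exists2 c : R, 0 < c &
  forall a m, (forall n, 0 <= a n) ->
  \sum_(n < m) n.+1%:R `^ (- 1 - alpha) * (\sum_(k < n.+1) a k) ^+ 2 <=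
  c * \sum_(n < m) n.+1%:R `^ (1 - alpha) * a n ^+ 2.
Proof.
move=> alpha0; pose p := alpha / 2; have p0 : 0 < p by rewrite divr_gt0.
have alphaE : alpha = p + p by rewrite /p -splitr.
have [c c0 sumc] := @sum_powR_le p p0.
have pV0 : 0 < p^-1 by rewrite invr_gt0.
exists (c * (1 + p^-1)); first by rewrite mulr_gt0// addr_gt0.
move=> a m a0.
pose b k := a k ^+ 2 / k.+1%:R `^ (p - 1).
have b0 k : 0 <= b k by rewrite mulr_ge0 ?sqr_ge0// invr_ge0 powR_ge0.
have inner (n : nat) : (\sum_(k < n.+1) a k) ^+ 2 <=
    c * n.+1%:R `^ p * \sum_(k < n.+1) b k.
  apply: le_trans (@cauchy_schwarz_sum n _ (fun k => k.+1%:R `^ (p - 1)) _) _.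
    by move=> k; rewrite powR_gt0.
  by rewrite ler_wpM2r ?sumc// sumr_ge0// => k _; exact: b0.
apply: le_trans (_ : \sum_(n < m) c * (n.+1%:R `^ (- 1 - p) *
    \sum_(k < n.+1) b k) <= _).
  apply: ler_sum => n _.
  apply: le_trans (ler_wpM2l (powR_ge0 _ _) (inner n)) _; rewrite {}alphaE.
  rewrite (_ : - 1 - p = - 1 - (p + p) + p); last by ring.
  rewrite [in leRHS]powRD ?pnatr_eq0 ?implybT//.
  by rewrite le_eqVlt; apply/orP; left; apply/eqP; ring.
rewrite -mulr_sumr -mulrA ler_wpM2l ?(ltW c0)//.
under eq_bigr => n _ do
  rewrite (big_ord_widen m (fun k => b k) (ltn_ord n)) mulr_sumr.
rewrite (exchange_big_dep xpredT)//= mulr_sumr; apply: ler_sum => k _.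
rewrite -mulr_suml.
have -> : \sum_(n < m | (k < n.+1)%N) n.+1%:R `^ (- 1 - p) =
    \sum_(k <= n < m) n.+1%:R `^ (- 1 - p) :> R by rewrite big_geq_mkord.
apply: le_trans (ler_wpM2r (b0 k) (@sum_powR_tail_le p k m p0)) _.
rewrite -mulrA ler_wpM2l ?addr_ge0 ?(ltW pV0)//.
rewrite /b -powRN mulrCA -powRD ?pnatr_eq0 ?implybT// mulrC.
by rewrite (_ : - p - (p - 1) = 1 - alpha)// alphaE; ring.
Qed.

(** An inequality, so that [m < N] is allowed. *)
Lemma sum_split_le (F : nat -> R) (N m : nat) : (forall n, 0 <= F n) ->
  \sum_(n < m) F n <= \sum_(0 <= n < N) F n + \sum_(N <= n < m) F n.
Proof.
move=> F0; rewrite -(big_mkord xpredT).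
have [Nm|mN] := leqP N m; first by rewrite -big_cat_nat.
rewrite [X in _ <= _ + X]big_geq ?(ltnW mN)// addr0.
rewrite (big_cat_nat (leq0n m) (ltnW mN)) /= lerDl.
by apply: sumr_ge0.
Qed.

Lemma powRN_cvg0 (p : R) : 0 < p -> n.+1%:R `^ (- p) @[n --> \oo] --> (0 : R).
Proof.
move=> p0; apply/cvgrPdist_le => e e0; near=> n.
rewrite sub0r normrN ger0_norm ?powR_ge0// powRN -[leRHS]invrK.
rewrite lef_pV2 ?posrE ?powR_gt0 ?invr_gt0//.
have -> : e^-1 = (e^-1 `^ p^-1) `^ p.
  by rewrite -powRrM mulVf ?gt_eqF// powRr1// invr_ge0 ltW.
rewrite ge0_ler_powR ?nnegrE ?powR_ge0 ?(ltW p0)//.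
apply: (@le_trans _ _ n%:R); last by rewrite ler_nat.
by near: n; exact: nbhs_infty_ger.
Unshelve. all: by end_near.
Qed.

End real_inequalities.

Local Open Scope complex_scope.

(** * Complex moduli, and power series with coefficients of polynomial growth *)

Section complex_series.
Context {R : realType}.
Local Notation C := (R[i]^o).
Local Notation normc := ComplexField.Normc.normc.
Implicit Types (z w : C) (u b : nat -> C).

Lemma norm_complexE z : `|z| = (normc z)%:C. Proof. by []. Qed.

Lemma normc_ge0 z : 0 <= normc z.
Proof. by case: z => x y; exact: sqrtr_ge0. Qed.

Lemma normc_sqr z : normc z ^+ 2 = complex.Re z ^+ 2 + complex.Im z ^+ 2.
Proof. by case: z => x y; rewrite /= sqr_sqrtr// addr_ge0 ?sqr_ge0. Qed.

Lemma normc_le_ReIm z : normc z <= `|complex.Re z| + `|complex.Im z|.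
Proof.
rewrite -(@ler_pXn2r _ 2) ?nnegrE ?normc_ge0 ?addr_ge0//.
by rewrite normc_sqr sqrrD !real_normK ?num_real// addrAC lerDl mulrn_wge0// mulr_ge0.
Qed.

Lemma normc_ge_abs_Re z : `|complex.Re z| <= normc z.
Proof.
rewrite -(@ler_pXn2r _ 2) ?nnegrE ?normc_ge0//.
by rewrite normc_sqr real_normK ?num_real// lerDl sqr_ge0.
Qed.

Lemma normc_ge_abs_Im z : `|complex.Im z| <= normc z.
Proof.
rewrite -(@ler_pXn2r _ 2) ?nnegrE ?normc_ge0//.
by rewrite normc_sqr real_normK ?num_real// lerDr sqr_ge0.
Qed.

Lemma normcX z n : normc (z ^+ n) = normc z ^+ n.
Proof.
elim: n => [|n IH]; first by rewrite !expr0 ComplexField.Normc.normc1.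
by rewrite !exprS ComplexField.Normc.normcM IH.
Qed.

Lemma normc_real (x : R) : normc x%:C = `|x|.
Proof. by rewrite /= expr0n addr0 sqrtr_sqr. Qed.

Lemma normc_nat n : normc (n%:R : C) = n%:R.
Proof. by rewrite -[n%:R : C](rmorph_nat (real_complex R)) normc_real normr_nat. Qed.

Lemma ler_normcD z w : normc (z + w) <= normc z + normc w.
Proof. exact: le_normcD. Qed.

Lemma normc_triangle z w : normc z <= normc (z - w) + normc w.
Proof. by rewrite -{1}(subrK w z) ler_normcD. Qed.

Lemma normc_distC z w : normc (z - w) = normc (w - z).
Proof. by rewrite -normcN opprB. Qed.

Lemma normc_sum_le (I : Type) (r : seq I) (P : pred I) (F : I -> C) :
  normc (\sum_(i <- r | P i) F i) <= \sum_(i <- r | P i) normc (F i).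
Proof.
elim/big_ind2: _ => [|x x' y y' h h'|//]; first by rewrite ComplexField.Normc.normc0.
by apply: le_trans (ler_normcD _ _) _; exact: lerD.
Qed.

(** A positive element of [R[i]] has imaginary part 0, so every epsilon may be taken real. *)
Lemma gt0_complexE (e : R[i]) : 0 < e -> exists2 e' : R, 0 < e' & e = e'%:C.
Proof.
by case: e => x y; rewrite ltcE /= => /andP[/eqP -> x0]; exists x.
Qed.

Lemma cvg_complexP (T : Type) (F : set_system T) {FF : Filter F} (f : T -> C) l :
  (f @ F --> l) <-> (forall e : R, 0 < e -> \forall x \near F, normc (l - f x) <= e).
Proof.
split=> [/cvgrPdist_le h e e0|h].
  have : 0 < e%:C by rewrite ltcR.
  move=> /h; apply: filterS => x; by rewrite norm_complexE lecR.
apply/cvgrPdist_le => _ /gt0_complexE[e e0 ->].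
by have := h e e0; apply: filterS => x; rewrite norm_complexE lecR.
Qed.

Lemma sum_geometric_le (x : R) n : 0 <= x < 1 -> \sum_(k < n) x ^+ k <= (1 - x)^-1.
Proof.
move=> /andP[x0 x1]; have y0 : 0 < 1 - x by rewrite subr_gt0.
rewrite -[leRHS]mul1r ler_pdivlMr//.
have -> : (\sum_(k < n) x ^+ k) * (1 - x) = 1 - x ^+ n.
  elim: n => [|n IH]; first by rewrite big_ord0 mul0r subrr.
  by rewrite big_ord_recr /= mulrDl IH exprS; ring.
by rewrite gerBl exprn_ge0.
Qed.

(* The library has no completeness for [R[i]]: the real and imaginary parts are
   summed separately. *)
Lemma dominated_series_cvg u (K x : R) : 0 <= x < 1 ->
  (forall n, normc (u n) <= K * x ^+ n) ->
  exists2 l : C, series u @ \oo --> l & normc l <= K / (1 - x).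
Proof.
move=> x01 uK; have /andP[x0 x1] := x01.
have K0 : 0 <= K by have := le_trans (normc_ge0 _) (uK 0%N); rewrite mulr1.
have cvgr (v : nat -> R) : (forall n, `|v n| <= K * x ^+ n) ->
    exists l : R, series v @ \oo --> l.
  move=> vK; apply/cvg_ex; apply: (@normed_cvg _ (R^o)).
  apply: series_le_cvg (vK) _ => //.
  - by move=> n; rewrite mulr_ge0// exprn_ge0.
  - by apply: is_cvg_geometric_series; rewrite ger0_norm.
have [lr hr] : exists l : R, series (fun n => complex.Re (u n)) @ \oo --> l.
  by apply: cvgr => n; exact: le_trans (normc_ge_abs_Re _) (uK n).
have [li hi] : exists l : R, series (fun n => complex.Im (u n)) @ \oo --> l.
  by apply: cvgr => n; exact: le_trans (normc_ge_abs_Im _) (uK n).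
have uE n : series u n =
    series (fun n => complex.Re (u n)) n +i* series (fun n => complex.Im (u n)) n.
  elim: n => [|n IH]; first by rewrite /series /= !big_geq.
  rewrite !seriesSr IH /=; by case: (u n).
have [l cvgl] : exists l : C, series u @ \oo --> l.
  exists (lr +i* li); apply/cvg_complexP => e e0.
  have e20 : 0 < e / 2 by rewrite divr_gt0.
  move/cvgrPdist_le: hr => /(_ _ e20); move/cvgrPdist_le: hi => /(_ _ e20).
  apply: filterS2 => n hi hr; apply: le_trans (normc_le_ReIm _) _.
  by rewrite uE /= (splitr e) lerD.
exists l => //; apply/ler_addgt0Pr => e e0.
move/cvg_complexP: (cvgl) => /(_ _ e0)[n _ /(_ n (leqnn n))] /= h.
apply: le_trans (normc_triangle _ (series u n)) _; rewrite addrC lerD//.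
rewrite /series /= big_mkord; apply: le_trans (normc_sum_le _ _ _ _) _.
apply: (@le_trans _ _ (\sum_(k < n) K * x ^+ k)); first exact: ler_sum.
by rewrite -mulr_sumr ler_wpM2l// sum_geometric_le.
Qed.

(** Each unit of [d] is paid by passing from y to t = (1 + y) / 2: one has y <= t^2, and one of the
    two factors t^n absorbs n + 1, because (n + 1) t^n is at most a geometric sum, hence at most 1 /
    (1 - t). *)
Lemma poly_geometric_dominated (d : nat) (x : R) : 0 <= x < 1 ->
  exists K y : R, [/\ 0 <= K, 0 <= y < 1 &
    forall n, n.+1%:R ^+ d * x ^+ n <= K * y ^+ n].
Proof.
move=> x01; elim: d => [|d [K [y [K0 /andP[y0 y1] h]]]].
  by exists 1, x; split=> // n; rewrite expr0.
pose t := (1 + y) / 2.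
have t0 : 0 <= t by rewrite divr_ge0// addr_ge0.
have t1 : t < 1 by rewrite ltr_pdivrMr// mul1r (_ : 2 = 1 + 1)// ltrD2l.
have yt : y <= t ^+ 2.
  rewrite -subr_ge0 (_ : _ - _ = ((1 - y) / 2) ^+ 2) ?sqr_ge0//.
  by rewrite /t; field.
have s0 : 0 < 1 - t by rewrite subr_gt0.
exists (K / (1 - t)), t; split; first by rewrite divr_ge0// ltW.
  by rewrite t0.
move=> n; rewrite exprS -mulrA.
apply: le_trans (ler_wpM2l (ler0n _ _) (h n)) _.
rewrite mulrCA -mulrA ler_wpM2l//.
have nt : n.+1%:R * t ^+ n * (1 - t) <= 1 - t ^+ n.+1.
  elim: n => [|n IH]; first by rewrite mulr1 mul1r.
  rewrite -natr1.
  have tn1 : t ^+ n.+1 <= 1 by rewrite exprn_ile1// ltW.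
  have := ler_wpM2l t0 IH.
  rewrite (exprS t n.+1) (exprS t n) in tn1 *; nra.
apply: (@le_trans _ _ (n.+1%:R * t ^+ n * t ^+ n)).
  by rewrite -mulrA ler_wpM2l// -exprMn -expr2 lerXn2r ?nnegrE ?exprn_ge0.
rewrite ler_wpM2r ?exprn_ge0// -[leRHS]mul1r ler_pdivlMr// (le_trans nt)//.
by rewrite gerBl exprn_ge0.
Qed.

(** A class wide enough for the coefficients of [dirichlet alpha] with alpha < 2, stable under
    [cesaro_coef] with bounded moments, and narrow enough for convergence on the whole disk. *)
Definition poly_growth b : Prop :=
  exists d (K : R), forall n, normc (b n) <= K * n.+1%:R ^+ d.

(** The exponent [e] leaves room for the factors n and n^2 of termwise differentiation. *)
Lemma poly_growth_dominated b (e : nat) (x : R) : poly_growth b -> 0 <= x < 1 ->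
  exists K y : R, [/\ 0 <= K, 0 <= y < 1 &
    forall n, normc (b n) * (n.+1%:R ^+ e * x ^+ n) <= K * y ^+ n].
Proof.
move=> [d [K bK]] x01.
have [L [y [L0 y01 h]]] := @poly_geometric_dominated (d + e) x x01.
have K0 : 0 <= K by have := le_trans (normc_ge0 _) (bK 0%N); rewrite expr1n mulr1.
have /andP[x0 _] := x01.
exists (K * L), y; split=> //; first exact: mulr_ge0.
move=> n; rewrite -mulrA.
apply: le_trans (_ : K * (n.+1%:R ^+ (d + e) * x ^+ n) <= _); last first.
  by rewrite ler_wpM2l.
rewrite exprD -mulrA mulrA ler_wpM2r//.
by rewrite mulr_ge0 ?exprn_ge0.
Qed.

(** Convertible with [cesaro mu f] when [b] is [cesaro_coef mu (taylor_coef f)]. *)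
Definition disk_sum b z : C :=
  if z \in @unit_disk R then limn (power_series b z) else 0.

Lemma unit_diskE z : unit_disk z <-> normc z < 1.
Proof.
rewrite /unit_disk /= norm_complexE -[1 : R[i]]/((1 : R)%:C).
by rewrite ltcR.
Qed.

Lemma poly_growth_series_cvg b z : poly_growth b -> normc z < 1 ->
  power_series b z @ \oo --> disk_sum b z.
Proof.
move=> bd z1; rewrite /disk_sum ifT; last exact/mem_set/unit_diskE.
have z01 : 0 <= normc z < 1 by rewrite normc_ge0.
have [K [y [K0 y01 h]]] := @poly_growth_dominated b 0 _ bd z01.
have [n|l hl _] := @dominated_series_cvg (fun n => b n * z ^+ n) K y y01.
  by rewrite ComplexField.Normc.normcM normcX -[normc z ^+ n]mul1r.
by apply/cvg_ex; exists l.
Qed.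

Lemma disk_sum_expansion b : poly_growth b -> power_series_expansion (disk_sum b) b.
Proof. by move=> bd z /unit_diskE; exact: poly_growth_series_cvg. Qed.

(** With E_n the expression inside [normc], induct on E_(n+1) = w E_n + n z^(n-1) (w - z)^2. The
    factor r^2 on the left stands in for an exponent n - 2 on the right. *)
Lemma normc_expr_taylor_le (r : R) z w n : normc z <= r -> normc w <= r ->
  r ^+ 2 * normc (w ^+ n - z ^+ n - n%:R * z ^+ n.-1 * (w - z)) <=
  n%:R ^+ 2 * r ^+ n * normc (w - z) ^+ 2.
Proof.
move=> zr wr; have r0 : 0 <= r := le_trans (normc_ge0 _) zr.
elim: n => [|n IH].
  by rewrite !expr0 subrr !mul0r subr0 ComplexField.Normc.normc0 mulr0 expr0n !mul0r.
have -> : w ^+ n.+1 - z ^+ n.+1 - n.+1%:R * z ^+ n.+1.-1 * (w - z) =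
    w * (w ^+ n - z ^+ n - n%:R * z ^+ n.-1 * (w - z)) +
    n%:R * z ^+ n.-1 * (w - z) ^+ 2.
  case: n {IH} => [|n]; first by rewrite /= !expr1 !expr0; ring.
  by rewrite -[n.+1.-1]/n -[n.+2.-1]/n.+1 -[n.+2%:R]natr1 !exprS; ring.
have zn : r ^+ 2 * (n%:R * normc z ^+ n.-1) <= n%:R * r ^+ n.+1.
  case: n {IH} => [|n]; first by rewrite !mul0r mulr0.
  rewrite mulrCA ler_wpM2l// [n.+1.-1]/= (exprD r 2 n) ler_wpM2l ?exprn_ge0//.
  by rewrite lerXn2r// nnegrE normc_ge0.
have d0 : 0 <= normc (w - z) ^+ 2 by rewrite exprn_ge0// normc_ge0.
apply: le_trans (ler_wpM2l _ (ler_normcD _ _)) _; first exact: exprn_ge0.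
rewrite !ComplexField.Normc.normcM !normcX normc_nat mulrDr.
apply: (@le_trans _ _ (r * (n%:R ^+ 2 * r ^+ n * normc (w - z) ^+ 2) +
   n%:R * r ^+ n.+1 * normc (w - z) ^+ 2)).
  apply: lerD.
    rewrite mulrCA; apply: le_trans (ler_wpM2l (normc_ge0 _) IH) _.
    by rewrite ler_wpM2r// !mulr_ge0 ?exprn_ge0 ?normc_ge0.
  by rewrite -expr2 mulrA ler_wpM2r.
rewrite -subr_ge0 -natr1 (exprS r n).
rewrite (_ : _ - _ = (n%:R + 1) * r * r ^+ n * normc (w - z) ^+ 2); last by ring.
by rewrite !mulr_ge0 ?exprn_ge0 ?addr_ge0 ?normc_ge0.
Qed.

(** Let L be the sum of the termwise derivatives. Summing the second-order bounds
    [normc_expr_taylor_le] gives |f(w) - f(z) - L (w - z)| <= M |w - z|^2 on the disk of radius r,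
    so L is the derivative. *)
Lemma disk_sum_derivable b z : poly_growth b -> normc z < 1 ->
  derivable (disk_sum b) z 1.
Proof.
move=> bd z1; have [r /andP[zr r1]] : exists r, normc z < r < 1.
  by exists ((normc z + 1) / 2); rewrite !midf_lt.
have r0 : 0 < r := le_lt_trans (normc_ge0 _) zr.
have r01 : 0 <= r < 1 by rewrite ltW.
have [K [y [K0 y01 bK]]] := @poly_growth_dominated b 2 r bd r01.
have y10 : 0 < 1 - y by rewrite subr_gt0; case/andP: y01.
have [n|L hL _] := @dominated_series_cvg
    (fun n => b n * (n%:R * z ^+ n.-1)) (K / r) y y01.
  rewrite !ComplexField.Normc.normcM normcX normc_nat.
  rewrite mulrAC ler_pdivlMr//; apply: le_trans (bK n).
  rewrite -mulrA ler_wpM2l ?normc_ge0//.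
  case: n => [|n]; first by rewrite !mul0r mulr_ge0 ?exprn_ge0// ltW.
  rewrite -mulrA ler_pM ?mulr_ge0 ?exprn_ge0 ?normc_ge0 ?(ltW r0)//.
    by rewrite -natrX ler_nat (leq_trans (leqnSn _))// leq_pmulr.
  rewrite exprSr ler_wpM2r ?(ltW r0)// lerXn2r ?nnegrE ?normc_ge0 ?(ltW r0)//.
  exact: ltW.
pose M := K / r ^+ 2 / (1 - y).
have M0 : 0 <= M by rewrite !mulr_ge0 ?invr_ge0 ?exprn_ge0// ltW.
have key w : normc w <= r ->
    normc (disk_sum b w - disk_sum b z - L * (w - z)) <= M * normc (w - z) ^+ 2.
  move=> wr; have w1 := le_lt_trans wr r1.
  have d0 : 0 <= normc (w - z) ^+ 2 by rewrite exprn_ge0// normc_ge0.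
  have r20 : 0 < r ^+ 2 by rewrite exprn_gt0.
  have [n|l cl hl] := @dominated_series_cvg (fun n => b n *
     (w ^+ n - z ^+ n - n%:R * z ^+ n.-1 * (w - z)))
     (K / r ^+ 2 * normc (w - z) ^+ 2) y y01.
    rewrite ComplexField.Normc.normcM -(ler_pM2l r20).
    rewrite [leRHS](_ : _ = K * y ^+ n * normc (w - z) ^+ 2); last first.
      by field; rewrite gt_eqF.
    apply: (@le_trans _ _ (normc (b n) * (n.+1%:R ^+ 2 * r ^+ n) *
        normc (w - z) ^+ 2)); last by rewrite ler_wpM2r.
    rewrite mulrCA -[leRHS]mulrA ler_wpM2l ?normc_ge0//.
    apply: le_trans (@normc_expr_taylor_le r z w n (ltW zr) wr) _.
    rewrite ler_wpM2r// ler_wpM2r ?exprn_ge0 ?(ltW r0)//.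
    by rewrite lerXn2r ?nnegrE// ler_nat.
  rewrite (_ : M * _ = K / r ^+ 2 * normc (w - z) ^+ 2 / (1 - y)); last first.
    by rewrite /M; ring.
  suff -> : disk_sum b w - disk_sum b z - L * (w - z) = l by [].
  apply: (@cvg_unique _ (@norm_hausdorff _ C) _ _ _ _ _ cl).
  rewrite (_ : series _ = power_series b w - power_series b z -
     (fun n => series (fun n => b n * (n%:R * z ^+ n.-1)) n * (w - z))).
    apply: cvgB; first by apply: cvgB; exact: poly_growth_series_cvg.
    exact: (cvgMr_tmp hL).
  apply/funext => n; rewrite !fctE /power_series /series /=.
  rewrite mulr_suml -!sumrB; apply: eq_bigr => k _; ring.
apply/cvg_ex; exists L; apply/cvg_complexP => e e0.
(* [M] may vanish, hence the bound e / (M + 1) on the increment. *)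
have M1 : 0 < M + 1 by rewrite ltr_wpDl.
near=> h.
have h0 : h != 0 by near: h; exact: nbhs_dnbhs_neq.
have hn0 : 0 < normc h.
  rewrite lt_neqAle normc_ge0 andbT eq_sym; apply: contra h0 => /eqP.
  by move=> /ComplexField.Normc.eq0_normc ->.
have hr : normc h <= r - normc z.
  rewrite -lecR; near: h; apply: dnbhs0_le.
  by rewrite ltcR subr_gt0.
have he : normc h <= e / (M + 1).
  by rewrite -lecR; near: h; apply: dnbhs0_le; rewrite ltcR divr_gt0.
have hz : normc (h + z) <= r.
  by apply: le_trans (ler_normcD _ _) _; rewrite -lerBrDr.
have := key _ hz; rewrite addrK => hkey.
rewrite /= [h *: 1]mulr1.
have -> : L - h^-1 *: (disk_sum b (h + z) - disk_sum b z) =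
    - (h^-1 * (disk_sum b (h + z) - disk_sum b z - L * h)) :> C.
  by rewrite mulrBr opprB mulrCA mulVf// mulr1.
rewrite normcN ComplexField.Normc.normcM ComplexField.Normc.normcV.
rewrite ler_pdivrMl//; apply: le_trans hkey _.
rewrite expr2 mulrA mulrC ler_wpM2l ?(ltW hn0)//.
apply: le_trans (ler_wpM2l M0 he) _.
by rewrite mulrCA ler_piMr ?(ltW e0)// ler_pdivrMr// mul1r lerDl.
Unshelve. all: by end_near.
Qed.

Lemma disk_sum_analytic b : poly_growth b -> analytic_disk (disk_sum b).
Proof.
move=> bd; split=> z; first by move/unit_diskE; exact: disk_sum_derivable.
by move=> z1; rewrite /disk_sum ifF//; apply/negbTE/negP => /set_mem.
Qed.

End complex_series.

(** * Coefficients of Dirichlet-type functions and of their Cesaro images *)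

Section dirichlet_coefficients.
Context {R : realType}.
Local Notation C := (R[i]^o).
Local Notation normc := ComplexField.Normc.normc.
Implicit Types (alpha M : R) (a b : nat -> C).

Definition dirichlet_term alpha b (n : nat) : R :=
  n.+1%:R `^ (1 - alpha) * normc (b n) ^+ 2.

Lemma dirichlet_term_ge0 alpha b n : 0 <= dirichlet_term alpha b n.
Proof. by rewrite mulr_ge0 ?powR_ge0 ?sqr_ge0. Qed.

(** Turns norm estimates into estimates of finite real sums. *)
Lemma dirichlet_sum_leP alpha b M : (dirichlet_sum alpha b <= M%:E)%E <->
  forall m, \sum_(n < m) dirichlet_term alpha b n <= M.
Proof.
have t0 n : (0 <= (dirichlet_term alpha b n)%:E)%E.
  by rewrite lee_fin dirichlet_term_ge0.
split=> [h m|h].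
  rewrite -lee_fin; apply: le_trans h; rewrite -sumEFin.
  have := @nneseries_lim_ge R (fun n => (dirichlet_term alpha b n)%:E) xpredT 0 m
    (fun n _ _ => t0 n).
  by rewrite big_mkord.
apply: lime_le; first by apply: is_cvg_nneseries => n _ _; exact: t0.
by apply: nearW => m; rewrite big_mkord sumEFin lee_fin; exact: h.
Qed.

Lemma dirichlet_sum_ltyP alpha b : (dirichlet_sum alpha b < +oo)%E <->
  exists M, forall m, \sum_(n < m) dirichlet_term alpha b n <= M.
Proof.
split=> [h|[M /dirichlet_sum_leP h]]; last exact: le_lt_trans h (ltry _).
exists (fine (dirichlet_sum alpha b)); apply/dirichlet_sum_leP.
by rewrite fineK// ge0_fin_numE// dirichlet_sum_ge0.
Qed.

(** For alpha < 2 the weight is at least 1 / (n + 1), so a single term bounds |b_n|^2 by M (n + 1),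
    which is at most ((M + 1) (n + 1))^2. *)
Lemma dirichlet_poly_growth alpha b : alpha < 2 ->
  (dirichlet_sum alpha b < +oo)%E -> poly_growth b.
Proof.
move=> alpha2 /dirichlet_sum_ltyP[M bM]; exists 1%N, (M + 1) => n.
have M0 : 0 <= M by have := bM 0%N; rewrite big_ord0.
have : dirichlet_term alpha b n <= M.
  apply: le_trans (bM n.+1); rewrite big_ord_recr /= lerDr.
  by apply: sumr_ge0 => k _; exact: dirichlet_term_ge0.
rewrite expr1 /dirichlet_term => h.
rewrite -(@ler_pXn2r _ 2) ?nnegrE ?normc_ge0 ?mulr_ge0 ?addr_ge0//.
have n1 : n.+1%:R^-1 <= n.+1%:R `^ (1 - alpha) :> R.
  rewrite -powR_inv1 ?ler0n// ler_powR ?ler1n//.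
  by lra.
have {}h : normc (b n) ^+ 2 <= M * n.+1%:R.
  rewrite -ler_pdivrMr ?ltr0n//; apply: le_trans h.
  by rewrite mulrC ler_wpM2r ?sqr_ge0.
apply: le_trans h _; rewrite exprMn ler_pM//.
  by rewrite sqrrD expr1n mulr1; have := sqr_ge0 M; lra.
by rewrite -natrX ler_nat leq_pmulr.
Qed.

Lemma disk_sum_dirichlet alpha b : alpha < 2 ->
  (dirichlet_sum alpha b < +oo)%E -> disk_sum b \in dirichlet_pred alpha.
Proof.
move=> alpha2 boo; have bg := @dirichlet_poly_growth _ _ alpha2 boo.
apply/dirichlet_predP; split; first exact: disk_sum_analytic.
by exists b => //; exact: disk_sum_expansion.
Qed.

(* Junk value [0] when [b] has infinite Dirichlet sum. *)
Definition dirichlet_of_coef alpha b : dirichlet alpha :=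
  match pselect (disk_sum b \in dirichlet_pred alpha) with
  | left h => Dirichlet h
  | right _ => 0
  end.

Lemma dirichlet_of_coef_fun alpha b : alpha < 2 ->
  (dirichlet_sum alpha b < +oo)%E ->
  dirichlet_of_coef alpha b = disk_sum b :> (C -> C).
Proof.
move=> alpha2 /(disk_sum_dirichlet _ _ alpha2) h.
by rewrite /dirichlet_of_coef; case: pselect.
Qed.

Lemma taylor_dirichlet_of_coef alpha b : alpha < 2 ->
  (dirichlet_sum alpha b < +oo)%E -> taylor_coef (dirichlet_of_coef alpha b) = b.
Proof.
move=> alpha2 boo; rewrite dirichlet_of_coef_fun//; apply: taylor_coefE.
exact: disk_sum_expansion _ (@dirichlet_poly_growth _ _ alpha2 boo).
Qed.

Lemma dirichlet_norm_leP alpha (f : dirichlet alpha) M : 0 <= M ->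
  dirichlet_norm f <= M <->
  forall m, \sum_(n < m) dirichlet_term alpha (taylor_coef f) n <= M ^+ 2.
Proof.
move=> M0; rewrite -dirichlet_sum_leP -(fineK (dirichlet_sum_fin_num f)) lee_fin.
have f0 : 0 <= fine (dirichlet_sum alpha (taylor_coef f)).
  by rewrite fine_ge0// dirichlet_sum_ge0.
rewrite /dirichlet_norm -{2}(sqr_sqrtr f0).
by rewrite ler_pXn2r// nnegrE sqrtr_ge0.
Qed.

Lemma taylorB alpha (f g : dirichlet alpha) :
  taylor_coef (f - g) = taylor_coef f - taylor_coef g.
Proof. by have := dirichlet_taylorD (-1) g f; rewrite !scaleN1r addrC => ->; rewrite addrC. Qed.

Lemma taylor_inj alpha (f g : dirichlet alpha) :
  taylor_coef f = taylor_coef g -> f = g.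
Proof.
move=> fg; apply/eqP; rewrite -subr_eq0; apply/eqP.
apply: dirichlet_norm0_eq0; apply/eqP; rewrite eq_le sqrtr_ge0 andbT.
have fg0 : taylor_coef (f - g) = fun=> 0.
  by rewrite taylorB fg; apply/funext => n; exact: subrr.
apply: (proj2 (dirichlet_norm_leP _ (f - g) _ (lexx 0))).
move=> m.
rewrite fg0.
rewrite expr0n.
apply: sumr_le0 => n _.
by rewrite /dirichlet_term ComplexField.Normc.normc0 expr0n mulr0.
Qed.

Section cesaro_coefficients.
Variable mu : {measure set (measurableTypeR R) -> \bar R}.

Lemma cesaro_coefD k a b :
  cesaro_coef mu (k *: a + b) = k *: cesaro_coef mu a + cesaro_coef mu b.
Proof.
apply/funext => n; rewrite /cesaro_coef !fctE.
rewrite big_split /= -scaler_sumr mulrDr; congr (_ + _).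
by rewrite [LHS]mulrCA.
Qed.

(** A partial sum of n + 1 coefficients costs one more degree. *)
Lemma cesaro_coef_growth M b : (forall n, `|moment mu n| <= M) ->
  poly_growth b -> poly_growth (cesaro_coef mu b).
Proof.
move=> muM [d [K bK]]; exists d.+1, (M * K) => n.
rewrite /cesaro_coef ComplexField.Normc.normcM normc_real -mulrA.
apply: ler_pM; rewrite ?normc_ge0//.
apply: le_trans (normc_sum_le _ _ _ _) _.
apply: (@le_trans _ _ (\sum_(k < n.+1) K * n.+1%:R ^+ d)).
  apply: ler_sum => k _; apply: le_trans (bK k) _.
  have K0 : 0 <= K by have := le_trans (normc_ge0 _) (bK 0%N); rewrite expr1n mulr1.
  by rewrite ler_wpM2l// lerXn2r ?nnegrE// ler_nat.
rewrite sumr_const card_ord le_eqVlt; apply/orP; left; apply/eqP.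
by rewrite exprS -[LHS]mulr_natl mulrCA.
Qed.

Lemma taylor_cesaro M (f : C -> C) : (forall n, `|moment mu n| <= M) ->
  poly_growth (taylor_coef f) ->
  taylor_coef (Defs.cesaro mu f) = cesaro_coef mu (taylor_coef f).
Proof.
move=> muM fg; apply: taylor_coefE.
by apply: (@disk_sum_expansion R (cesaro_coef mu (taylor_coef f)));
  exact: cesaro_coef_growth.
Qed.

End cesaro_coefficients.
End dirichlet_coefficients.

(** * Images of ultrafilters, and limits of bounded functions along them *)

Section ultrafilters.

Lemma ultra_fmap (T U : Type) (F : set_system T) (f : T -> U) :
  UltraFilter F -> UltraFilter (f @ F).
Proof.
move=> UF; split; first exact: fmap_proper_filter.
move=> G PG FG; apply/seteqP; split=> // A GA.
have [//|FC] := in_ultra_setVsetC (f @^-1` A) UF.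
have : G (~` A) by apply: FG.
by move=> GC; have [x []] := filter_ex (filterI GA GC).
Qed.

(** The image ultrafilter contains the compact segment [-r, r]. *)
Lemma ultra_bounded_cvg (R : realType) (T : Type) (F : set_system T)
    (f : T -> R) (r : R) : UltraFilter F ->
  (\forall x \near F, `|f x| <= r) -> exists l : R, f @ F --> l.
Proof.
move=> UF fr; have := @segment_compact R (- r) r.
rewrite compact_ultra => /(_ (f @ F) (ultra_fmap _ _ _ f UF)).
case=> [|l [_ h]]; last by exists l.
by apply: filterS fr => x; rewrite /= in_itv /= ler_norml.
Qed.

End ultrafilters.

(** * Compactness in Dirichlet-type spaces *)

Section dirichlet_compactness.
Context {R : realType}.
Local Notation C := (R[i]^o).
Local Notation normc := ComplexField.Normc.normc.
Implicit Types (alpha beta M : R) (a b : nat -> C).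

Lemma dirichlet_cvgP alpha (T : Type) (F : set_system T) {FF : Filter F}
    (f : T -> dirichlet alpha) (g : dirichlet alpha) :
  (f @ F --> g) <->
  (forall e : R, 0 < e -> \forall x \near F, dirichlet_norm (g - f x) <= e).
Proof.
split=> [/cvgrPdist_le h e e0|h].
  have : 0 < e%:C by rewrite ltcR.
  by move=> /h; apply: filterS => x; rewrite dirichlet_normE lecR.
apply/cvgrPdist_le => _ /gt0_complexE[e e0 ->].
by have := h e e0; apply: filterS => x; rewrite dirichlet_normE lecR.
Qed.

Lemma dirichlet_normN alpha (f : dirichlet alpha) :
  dirichlet_norm (- f) = dirichlet_norm f.
Proof.
have := dirichlet_normZ (-1) f.
by rewrite scaleN1r normcN ComplexField.Normc.normc1 mul1r.
Qed.

Lemma dirichlet_termB_le alpha a b n : dirichlet_term alpha (a - b) n <=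
  2 * dirichlet_term alpha a n + 2 * dirichlet_term alpha b n.
Proof.
rewrite /dirichlet_term !fctE [X in _ <= X + _]mulrCA [X in _ <= _ + X]mulrCA -mulrDr.
rewrite ler_wpM2l ?powR_ge0//.
have := le_normcD_sqr (a n) (- b n) (@ltr01 R).
by rewrite invr1 normcN.
Qed.

Lemma dirichlet_term_le_norm alpha (f : dirichlet alpha) n :
  dirichlet_term alpha (taylor_coef f) n <= dirichlet_norm f ^+ 2.
Proof.
have /dirichlet_norm_leP/(_ n.+1) := lexx (dirichlet_norm f).
rewrite big_ord_recr /= => h; apply: le_trans (h (sqrtr_ge0 _)); rewrite lerDr.
by apply: sumr_ge0 => k _; exact: dirichlet_term_ge0.
Qed.

(** Each term is a polynomial in the real and imaginary parts of the coefficient, so coefficientwise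
    convergence passes to finite sums. Subtracting [a] serves twice: a = 0 for bounds on the limit,
    a = b for convergence to it. *)
Lemma dirichlet_term_cvg alpha (T : Type) (F : set_system T) {FF : Filter F}
    (u : T -> nat -> C) b a (r : seq nat) :
  (forall n, complex.Re (u t n) @[t --> F] --> complex.Re (b n)) ->
  (forall n, complex.Im (u t n) @[t --> F] --> complex.Im (b n)) ->
  \sum_(n <- r) dirichlet_term alpha (u t - a) n @[t --> F] -->
  \sum_(n <- r) dirichlet_term alpha (b - a) n.
Proof.
move=> ub vb; apply: cvg_big => [|n _]; first exact: add_continuous.
have tE (c : nat -> C) : dirichlet_term alpha (c - a) n = n.+1%:R `^ (1 - alpha) *
    ((complex.Re (c n) - complex.Re (a n)) * (complex.Re (c n) - complex.Re (a n)) +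
     (complex.Im (c n) - complex.Im (a n)) * (complex.Im (c n) - complex.Im (a n))).
  rewrite /dirichlet_term normc_sqr !fctE -!expr2.
  by case: (c n) => ? ?; case: (a n).
under eq_cvg do rewrite tE.
rewrite tE; apply: cvgMl_tmp; apply: cvgD; apply: cvgM;
  by apply: cvgB => //; exact: cvg_cst.
Qed.

(** The modulus [N] is shared by all sequences of the set. Nonstrict bounds on finite sums survive
    coefficientwise limits. *)
Definition uniform_tails alpha (N : R -> nat) M b : Prop :=
  (forall m, \sum_(0 <= n < m) dirichlet_term alpha b n <= M) /\
  (forall e, 0 < e -> forall m, \sum_(N e <= n < m) dirichlet_term alpha b n <= e).

(** Along an ultrafilter the bounded coefficients converge, to a sequence [b] with the same bounds.
    The squared distance to the limit splits into a head of [N d] terms, which tends to 0, and a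
    uniformly small tail. *)
Lemma uniform_tails_compact alpha N M : alpha < 2 ->
  compact [set f : dirichlet alpha | uniform_tails alpha N M (taylor_coef f)].
Proof.
move=> alpha2; rewrite compact_ultra => F UF FK.
have bnd n : \forall f \near F, normc (taylor_coef (f : dirichlet alpha) n) <=
    1 + M / n.+1%:R `^ (1 - alpha).
  apply: filterS FK => f [fM _].
  set c := normc _; set w := n.+1%:R `^ _.
  have w0 : 0 < w by rewrite powR_gt0.
  have cM : c ^+ 2 <= M / w.
    rewrite ler_pdivlMr// mulrC; apply: le_trans (fM n.+1).
    rewrite big_nat_recr//= lerDr sumr_ge0// => k _.
    exact: dirichlet_term_ge0.
  (* The crude bound [c <= 1 + c ^+ 2] avoids a square root. *)
  apply: le_trans (_ : 1 + c ^+ 2 <= _); last by rewrite lerD2l.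
  have := sqr_ge0 (c - 1); have := sqr_ge0 c; nra.
have /choice[x hx] : forall n, exists l : R,
    complex.Re (taylor_coef (f : dirichlet alpha) n) @[f --> F] --> l.
  move=> n; apply: ultra_bounded_cvg; apply: filterS (bnd n) => f.
  exact: le_trans (normc_ge_abs_Re _).
have /choice[y hy] : forall n, exists l : R,
    complex.Im (taylor_coef (f : dirichlet alpha) n) @[f --> F] --> l.
  move=> n; apply: ultra_bounded_cvg; apply: filterS (bnd n) => f.
  exact: le_trans (normc_ge_abs_Im _).
pose b n : C := x n +i* y n.
have FF := @filter_filter _ F (@ultra_proper _ F UF).
have sumcvg a r := @dirichlet_term_cvg alpha _ F FF
  (fun f : dirichlet alpha => taylor_coef f) b a r hx hy.
have bt : uniform_tails alpha N M b.
  split=> [m|e e0 m].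
    have := sumcvg 0 (index_iota 0 m); rewrite subr0.
    under eq_cvg do rewrite subr0.
    move=> /cvgr_to_le; apply.
    by apply: filterS FK => f [].
  have := sumcvg 0 (index_iota (N e) m); rewrite subr0.
  under eq_cvg do rewrite subr0.
  move=> /cvgr_to_le; apply.
  by apply: filterS FK => f [_ /(_ e e0 m)].
have boo : (dirichlet_sum alpha b < +oo)%E.
  apply/dirichlet_sum_ltyP; exists M => m.
  by rewrite -(big_mkord xpredT); exact: (proj1 bt).
exists (dirichlet_of_coef alpha b).
have tb := @taylor_dirichlet_of_coef _ alpha b alpha2 boo.
split; first by rewrite /= tb.
apply/(@dirichlet_cvgP alpha _ F _ id) => e e0.
(* One share [d] is for the head and 2 + 2 shares are for the two tails, by [dirichlet_termB_le]. *)
pose d := e ^+ 2 / 5.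
have d0 : 0 < d by rewrite divr_gt0 ?exprn_gt0.
have := sumcvg b (index_iota 0 (N d)).
rewrite [X in _ --> X]big1; last first.
  by move=> n _; rewrite /dirichlet_term subrr ComplexField.Normc.normc0 expr0n mulr0.
move=> /(@cvgr_le R _ F _) /(_ d d0) => hd.
near=> f.
have ft : uniform_tails alpha N M (taylor_coef f) by near: f.
have fd : \sum_(0 <= n < N d) dirichlet_term alpha (taylor_coef f - b) n <= d.
  by near: f.
apply: (proj2 (dirichlet_norm_leP _ _ _ (ltW e0))) => m.
rewrite taylorB tb.
have sym n : dirichlet_term alpha (b - taylor_coef f) n =
    dirichlet_term alpha (taylor_coef f - b) n.
  by rewrite /dirichlet_term normc_distC.
under eq_bigr do rewrite sym.
apply: le_trans (@sum_split_le R _ (N d) m _) _.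
  by move=> n; exact: dirichlet_term_ge0.
have -> : e ^+ 2 = d + (2 * d + 2 * d) by rewrite /d; field.
apply: lerD => //.
apply: le_trans (ler_sum _ (fun n _ => dirichlet_termB_le _ _ _ n)) _.
rewrite big_split /= -!mulr_sumr lerD// ler_wpM2l//.
  exact: (proj2 ft).
exact: (proj2 bt).
Unshelve. all: by end_near.
Qed.

(** If the norms exceeded some e for arbitrarily large indices, an ultrafilter containing those
    indices would carry [T (f N)] to a limit g, by compactness; all coefficients of g vanish, so g =
    0, a contradiction. *)
Lemma compact_operator_weak_null alpha beta
    (T : {linear dirichlet alpha -> dirichlet beta}) (f : nat -> dirichlet alpha) :
  compact_operator T -> (forall N, dirichlet_norm (f N) <= 1) ->
  (forall n, normc (taylor_coef (T (f N)) n) @[N --> \oo] --> (0 : R)) ->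
  dirichlet_norm (T (f N)) @[N --> \oo] --> (0 : R).
Proof.
move=> Tc f1 coef0; apply/cvgrPdist_le => e e0; apply: contrapT => ne.
pose D := [set N : nat | ~ `|0 - dirichlet_norm (T (f N))| <= e].
(* Otherwise all large N would satisfy the bound that [ne] denies. *)
have PD : ProperFilter (within D \oo).
  apply: Build_ProperFilter; rewrite /within /=; apply: contra_not ne.
  by apply: filterS => N; exact: contrapT.
have [G [UG FG]] := ultraFilterLemma PD.
have GD : G D by apply: FG; apply: nearW.
have Goo A : (\forall N \near \oo, A N) -> G A.
  by move=> h; apply: FG; apply: filterS h => N.
have UTG := ultra_fmap _ _ _ (fun N => T (f N)) UG.
move: Tc; rewrite /compact_operator compact_ultra => /(_ _ UTG).
case=> [|g [_ /= hg]].
  apply: nearW => N; apply: subset_closure; exists (f N) => //=.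
  rewrite dirichlet_normE -[1 : R[i]]/((1 : R)%:C) lecR; exact: f1.
have GF := @filter_filter _ G (@ultra_proper _ G UG).
have {}hg := proj1 (@dirichlet_cvgP beta _ G GF (fun N => T (f N)) g) hg.
have g0 : g = 0.
  apply: taylor_inj; apply/funext => n.
  have -> : taylor_coef (0 : dirichlet beta) n = 0.
    by rewrite -[0 : dirichlet beta](subrr 0) taylorB; exact: subrr.
  pose w : R := n.+1%:R `^ (1 - beta).
  have w0 : 0 < w by rewrite powR_gt0.
  apply: ComplexField.Normc.eq0_normc; apply/eqP.
  rewrite eq_le normc_ge0 andbT -(@ler_pXn2r _ 2) ?nnegrE ?normc_ge0// expr0n.
  rewrite -(pmulr_rle0 _ w0); apply/ler_addgt0Pr => d d0; rewrite add0r.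
  (* The n-th coefficient of g is that of [g - T (f N)] plus that of [T (f N)]. The number [c]
     bounds the norm of the former function and the modulus of the latter coefficient, and solves 2
     c^2 + 2 w c^2 = d. *)
  pose c := Num.sqrt (d / (2 + 2 * w)).
  have w1 : 0 < 2 + 2 * w by rewrite addr_gt0// mulr_gt0.
  have c2 : c ^+ 2 = d / (2 + 2 * w) by rewrite sqr_sqrtr// divr_ge0 ?ltW.
  have c0 : 0 < c by rewrite sqrtr_gt0 divr_gt0.
  have h1 := hg c c0.
  have h2 : G [set N | normc (taylor_coef (T (f N)) n) <= c].
    by apply: Goo; exact: cvgr_le (coef0 n) _ c0.
  have [N [/= N1 N2]] := filter_ex (filterI h1 h2).
  have := @dirichlet_termB_le beta (taylor_coef (g - T (f N)))
     (- taylor_coef (T (f N))) n.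
  rewrite taylorB opprK subrK => h; apply: le_trans h _.
  have -> : d = 2 * c ^+ 2 + 2 * (w * c ^+ 2).
    by rewrite c2; field; rewrite gt_eqF.
  apply: lerD; rewrite ler_wpM2l//.
    rewrite -taylorB; apply: le_trans (dirichlet_term_le_norm _ _ _) _.
    by rewrite lerXn2r// nnegrE ?sqrtr_ge0 ?ltW.
  rewrite ler_wpM2l ?(ltW w0)// lerXn2r ?nnegrE ?normc_ge0 ?(ltW c0)//.
  by rewrite fctE normcN.
have [N [/= N1]] := filter_ex (filterI (hg e e0) GD).
have {}N1 : dirichlet_norm (T (f N)) <= e.
  by move: N1; rewrite g0 sub0r dirichlet_normN.
by apply; rewrite distrC subr0 ger0_norm ?sqrtr_ge0.
Qed.

End dirichlet_compactness.

(** * Moments and tails of a finite measure *)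

Section moments.
Context {R : realType}.

Lemma bernoulli_ineq (y : R) n : -1 <= y -> 1 + n%:R * y <= (1 + y) ^+ n.
Proof.
move=> y1; elim: n => [|n IH]; first by rewrite mul0r addr0.
have y10 : 0 <= 1 + y by lra.
rewrite exprS; apply: le_trans (ler_wpM2l y10 IH).
rewrite -subr_ge0 -natr1 (_ : _ - _ = n%:R * y ^+ 2); last by ring.
by rewrite mulr_ge0 ?sqr_ge0.
Qed.

(** Let y = 1 / (n + 1). Bernoulli gives (1 + y)^(n+1) >= 2, and (1 - y) (1 + y) <= 1, so (1 -
    y)^(n+1) <= 1/2; Bernoulli again gives 1 - k y <= (1 - y)^k. *)
Lemma expr_le_half (x : R) (k n : nat) : 0 <= x -> x <= 1 - k%:R / n.+1%:R ->
  x ^+ n.+1 <= 2^-1 ^+ k.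
Proof.
move=> x0 xk; pose y : R := n.+1%:R^-1.
have y0 : 0 < y by rewrite invr_gt0.
have y1 : y <= 1 by rewrite invf_le1// ler1n.
have ny : n.+1%:R * y = 1 by rewrite divff.
have half : (1 - y) ^+ n.+1 <= 2^-1.
  have h1 : 2 <= (1 + y) ^+ n.+1.
    by apply: le_trans (bernoulli_ineq y n.+1 _); rewrite ?ny//; lra.
  have h2 : (1 - y) ^+ n.+1 * (1 + y) ^+ n.+1 <= 1.
    by rewrite -exprMn exprn_ile1//; nra.
  rewrite -[leRHS]mul1r ler_pdivlMr//; apply: le_trans h2.
  by rewrite ler_wpM2l// exprn_ge0// subr_ge0.
have xy : x <= (1 - y) ^+ k.
  apply: le_trans xk _.
  have := bernoulli_ineq (- y) k; rewrite mulrN; apply; lra.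
apply: (@le_trans _ _ (((1 - y) ^+ k) ^+ n.+1)).
  by rewrite lerXn2r ?nnegrE ?exprn_ge0 ?subr_ge0.
by rewrite -exprM mulnC exprM lerXn2r ?nnegrE ?exprn_ge0 ?subr_ge0.
Qed.

(** The full series has the value 52, and the remainder has a closed form. The cube dominates (k +
    1)^s for the exponents s <= 3 used later. *)
Lemma sum_cube_half_le n : \sum_(k < n) 2^-1 ^+ k * k.+1%:R ^+ 3 <= 52 :> R.
Proof.
have -> : \sum_(k < n) 2^-1 ^+ k * k.+1%:R ^+ 3 =
    52 - (2 * n%:R ^+ 3 + 12 * n%:R ^+ 2 + 36 * n%:R + 52) * 2^-1 ^+ n :> R.
  elim: n => [|n IH].
    by rewrite big_ord0; field.
  by rewrite big_ord_recr /= IH -natr1 (exprS _ n); field.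
by rewrite gerBl mulr_ge0 ?exprn_ge0//.
Qed.

Variable mu : {finite_measure set (measurableTypeR R) -> \bar R}.

Definition tail_mass (t : R) : R := fine (mu `[t, 1[%classic).

Lemma tail_massE t : mu `[t, 1[%classic = (tail_mass t)%:E.
Proof. by rewrite /tail_mass fineK// fin_num_measure. Qed.

Lemma tail_mass_ge0 t : 0 <= tail_mass t.
Proof. exact: fine_ge0. Qed.

Lemma tail_mass_le (t u : R) : t <= u -> tail_mass u <= tail_mass t.
Proof.
move=> tu; rewrite -lee_fin -!tail_massE le_measure ?inE//.
by apply: subset_itv; rewrite bnd_simp.
Qed.

Let meas_expr n (D : set (measurableTypeR R)) :
  @measurable_fun _ _ (measurableTypeR R) (\bar R) D (fun t => (t ^+ n)%:E).
Proof. by apply/measurable_EFinP; exact: measurable_funX. Qed.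

Let meas_indic (A D : set (measurableTypeR R)) : measurable A ->
  measurable_fun D (fun t : measurableTypeR R => ((\1_A t : R))%:E).
Proof. by move=> mA; apply/measurable_EFinP; exact: measurable_indic. Qed.

Lemma integrable_expr n : mu.-integrable `[0%R, 1%R[%classic
  (EFin \o (fun t : measurableTypeR R => t ^+ n)).
Proof.
have c1 : mu.-integrable `[0%R, 1%R[%classic (EFin \o cst (1 : R)).
  exact: finite_measure_integrable_cst.
apply: (le_integrable _ _ _ c1) => //; first exact: meas_expr.
move=> t; rewrite /= in_itv /= => /andP[t0 t1].
by rewrite lee_fin normr1 ger0_norm ?exprn_ge0// exprn_ile1// ltW.
Qed.

Lemma momentE n :
  (moment mu n)%:E = (\int[mu]_(t in `[0%R, 1%R[%classic) (t ^+ n)%:E)%E.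
Proof.
rewrite /moment /Rintegral fineK//.
by apply: integrable_fin_num => //; exact: integrable_expr.
Qed.

Lemma moment_ge0 n : 0 <= moment mu n.
Proof.
by apply: Rintegral_ge0 => t; rewrite /= in_itv /= => /andP[t0 _]; exact: exprn_ge0.
Qed.

Lemma moment_le (m n : nat) : (m <= n)%N -> moment mu n <= moment mu m.
Proof.
move=> mn; apply: le_Rintegral => //; try exact: integrable_expr.
move=> t; rewrite /= in_itv /= => /andP[t0 t1].
by rewrite ler_wiXn2l// ltW.
Qed.

Lemma moment_bounded n : `|moment mu n| <= moment mu 0.
Proof. by rewrite ger0_norm ?moment_ge0// moment_le. Qed.

(** Markov's inequality: on [t, 1) the power is least at t. *)
Lemma tail_mass_le_moment (t : R) n : 0 <= t -> t ^+ n * tail_mass t <= moment mu n.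
Proof.
move=> t0; rewrite -lee_fin momentE EFinM -tail_massE.
have sub : `[t, 1[%classic `<=` `[0%R, 1%R[%classic.
  by apply: subset_itv; rewrite bnd_simp.
apply: le_trans (ge0_subset_integral mu _ _ _ _ sub) => //.
  rewrite -integral_cst//; apply: ge0_le_integral => //.
  - by move=> x _; rewrite lee_fin exprn_ge0.
  - move=> x; rewrite /= in_itv /= => /andP[tx _].
    by rewrite lee_fin lerXn2r// nnegrE// (le_trans t0).
- by move=> x; rewrite /= in_itv /= => /andP[x0 _]; rewrite lee_fin exprn_ge0.
Qed.

(** The integrand is bounded pointwise by the sum of the indicators of [A k] with weights 2^-k. *)
Lemma moment_le_sum n : moment mu n.+1 <=
  \sum_(k < n.+1) 2^-1 ^+ k * tail_mass (1 - k.+1%:R / n.+1%:R).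
Proof.
pose A k : set (measurableTypeR R) := `[1 - k.+1%:R / n.+1%:R, 1%R[%classic.
have A0 (k : 'I_n.+1) : A k `<=` `[0%R, 1%R[%classic.
  apply: subset_itv; rewrite bnd_simp//.
  by rewrite subr_ge0 ler_pdivrMr// mul1r ler_nat.
have mA k : measurable (A k) by exact: measurable_itv.
rewrite -lee_fin momentE.
have -> : (\sum_(k < n.+1) 2^-1 ^+ k * tail_mass (1 - k.+1%:R / n.+1%:R))%:E =
  (\int[mu]_(t in `[0%R, 1%R[%classic)
    \sum_(k < n.+1) ((2^-1 ^+ k)%:E * (\1_(A k) t)%:E))%E.
  rewrite ge0_integral_sum//.
  - rewrite -sumEFin; apply: eq_bigr => k _.
    rewrite ge0_integralZl//.
      rewrite integral_indic; [|by []|exact: mA].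
      have -> : A k `&` `[0%R, 1%R[ = A k by apply/setIidPl; exact: A0.
      by rewrite EFinM -tail_massE.
    exact: (meas_indic _ _ (mA _)).
  - move=> k; apply: measurable_funeM; exact: (meas_indic _ _ (mA _)).
apply: ge0_le_integral => //.
- by move=> x; rewrite /= in_itv /= => /andP[x0 _]; rewrite lee_fin exprn_ge0.
- apply: emeasurable_sum => k; apply: measurable_funeM; exact: (meas_indic _ _ (mA _)).
move=> x; rewrite /= in_itv /= => /andP[x0 x1].
under eq_bigr do rewrite -EFinM.
rewrite sumEFin lee_fin.
have t0 (k : 'I_n.+1) : 0 <= 2^-1 ^+ k * \1_(A k) x :> R.
  by rewrite mulr_ge0 ?exprn_ge0.
(* The point 0 is set apart: its shell index would be n + 1, out of range. *)
have [->|xn0] := eqVneq x 0; first by rewrite expr0n sumr_ge0.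
have xgt0 : 0 < x by rewrite lt_neqAle eq_sym xn0.
have y0 : 0 <= (1 - x) * n.+1%:R by rewrite mulr_ge0// subr_ge0 ltW.
(* The single term whose index k is the integer part of (n + 1) (1 - x) suffices: x lies in [A k],
   and [expr_le_half] bounds the power. *)
have := truncn_itv y0; set k := Num.truncn _ => /andP[k1 k2].
have kn : (k < n.+1)%N.
  rewrite -(ltr_nat R); apply: le_lt_trans k1 _.
  by rewrite gtr_pMl// ltrBlDr ltrDl.
rewrite (bigD1 (Ordinal kn))//=.
have -> : \1_(A k) x = 1 :> R.
  rewrite indicE mem_set// /A /= in_itv /= x1 andbT.
  by rewrite lerBlDr -lerBlDl ler_pdivlMr// ltW.
rewrite mulr1 ler_wpDr ?sumr_ge0//.
by apply: expr_le_half => //; rewrite lerBrDr -lerBrDl ler_pdivrMr.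
Qed.

(** The cubic term allows a small [c]: it pays for the t far from 1, where the bound by [c] alone
    may fail, and contributes only order (n + 1)^-3. *)
Lemma moment_le_of_tail_mass (s c K : R) n : 0 <= s <= 3 -> 0 <= c -> 0 <= K ->
  (forall t, 0 <= t < 1 -> tail_mass t <= c * (1 - t) `^ s + K * (1 - t) ^+ 3) ->
  moment mu n.+1 <= 52 * (c * n.+1%:R `^ (- s) + K * n.+1%:R ^- 3).
Proof.
move=> /andP[s0 s3] c0 K0 h; apply: le_trans (moment_le_sum n) _.
set u : R := c * _ + _.
have u0 : 0 <= u by rewrite addr_ge0// mulr_ge0 ?powR_ge0// invr_ge0 exprn_ge0.
apply: (@le_trans _ _ (\sum_(k < n.+1) (2^-1 ^+ k * k.+1%:R ^+ 3) * u)); last first.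
  by rewrite -mulr_suml ler_wpM2r// sum_cube_half_le.
apply: ler_sum => k _; rewrite -mulrA ler_wpM2l ?exprn_ge0//.
apply: le_trans (h _ _) _.
  rewrite subr_ge0 ltrBlDr ltrDl divr_gt0// andbT.
  by rewrite ler_pdivrMr// mul1r ler_nat.
rewrite subKr /u mulrDr; apply: lerD.
  rewrite powRM// ?invr_ge0// -powR_inv1// -powRrM mulN1r.
  rewrite [leRHS]mulrCA ler_wpM2l// ler_wpM2r ?powR_ge0//.
  by rewrite -powR_mulrn// ler_powR// ler1n.
by rewrite [leRHS]mulrCA ler_wpM2l// exprMn exprVn.
Qed.

End moments.

(** * Vanishing Carleson conditions and decay of moments *)

Section carleson_moments.
Context {R : realType}.
Variables (s : R) (mu : {finite_measure set (measurableTypeR R) -> \bar R}).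
Hypotheses (s0 : 0 < s) (s2 : s < 2).

Definition moment_little_o : Prop := forall e : R, 0 < e ->
  exists N, forall n, (N <= n)%N -> moment mu n <= e * n.+1%:R `^ (- s).

Definition tail_little_o : Prop := forall e : R, 0 < e ->
  exists2 d : R, 0 < d < 1 &
  forall t, 1 - d <= t < 1 -> tail_mass mu t <= e * (1 - t) `^ s.

Lemma moment_little_o_bounded : moment_little_o ->
  exists2 e : R, 0 <= e & forall n, moment mu n <= e * n.+1%:R `^ (- s).
Proof.
move=> /(_ 1 ltr01)[N hN]; have m0 := moment_ge0 mu 0.
(* The second summand takes care of n < N, through mu[n] <= mu[0]. *)
exists (1 + moment mu 0 * N.+1%:R `^ s).
  by rewrite addr_ge0// mulr_ge0 ?powR_ge0.
move=> n; have [Nn|nN] := leqP N n.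
  apply: le_trans (hN n Nn) _; rewrite ler_wpM2r ?powR_ge0//.
  by rewrite lerDl mulr_ge0 ?powR_ge0.
apply: le_trans (@moment_le _ _ 0 n _) _ => //.
apply: (@le_trans _ _ (moment mu 0 * N.+1%:R `^ s * n.+1%:R `^ (- s))).
  rewrite -mulrA ler_peMr// powRN ler_pdivlMr ?powR_gt0// mul1r.
  by rewrite ge0_ler_powR ?nnegrE ?(ltW s0)// ler_nat ltnS ltnW.
by rewrite ler_wpM2r ?powR_ge0// lerDr.
Qed.

(** Take N + 1 as the integer part of 1 / (4 (1 - t)). Then (N + 1) (1 - t) lies between 1/8 and
    1/4, Bernoulli gives t^(2 (N + 1)) >= 1/2, and [tail_mass_le_moment] applies. *)
Lemma tail_of_moment :
  N.+1%:R `^ s * moment mu N.+1.*2 @[N --> \oo] --> (0 : R) -> tail_little_o.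
Proof.
(* The 2 inverts the lower bound 1/2 on the power of t; 8^s comes from 1 <= 8 (N + 1) (1 - t). *)
move=> h e e0; pose e' := e / (2 * 8 `^ s).
have e'0 : 0 < e' by rewrite divr_gt0// mulr_gt0// powR_gt0.
have [N0 _ hN0] := proj1 (@cvgrPdist_le _ _ _ _ _ _ _) h _ e'0.
(* For t this close to 1, the integer part exceeds [N0]. *)
exists (4 * N0.+2%:R)^-1.
  rewrite invr_gt0 mulr_gt0//= invf_lt1 ?mulr_gt0//.
  by rewrite -natrM ltr1n.
move=> t /andP[dt t1]; have x0 : 0 < 1 - t by rewrite subr_gt0.
have y0 : 0 <= (4 * (1 - t))^-1 by rewrite invr_ge0 mulr_ge0// ltW.
have yN : N0.+2%:R <= (4 * (1 - t))^-1.
  rewrite -[leLHS]invrK lef_pV2 ?posrE ?invr_gt0 ?mulr_gt0//.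
  by rewrite -ler_pdivlMl// -invfM lerBlDr addrC -lerBlDr.
have := truncn_itv y0; set M := Num.truncn _ => /andP[M1 M2].
have : (N0 < M)%N by rewrite -ltnS; apply: ltnW; rewrite -(ltr_nat R); exact: le_lt_trans yN M2.
case: M M1 M2 => // N M1 M2 N0N.
have {}hN0 := hN0 N N0N; rewrite /= sub0r normrN ger0_norm in hN0; last first.
  by rewrite mulr_ge0 ?powR_ge0 ?moment_ge0.
have M1' : N.+1%:R * (4 * (1 - t)) <= 1.
  by rewrite -ler_pdivlMr ?mulr_gt0// mul1r.
have M2' : 1 <= 8 * (N.+1%:R * (1 - t)).
  rewrite -(@ler_pM2r _ (4 * (1 - t))^-1) ?invr_gt0 ?mulr_gt0// mul1r.
  rewrite (_ : 8 * _ / _ = 2 * N.+1%:R); last by field; rewrite gt_eqF.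
  apply: le_trans (ltW M2) _; rewrite -natrM ler_nat.
  by rewrite mul2n -addnn -addn1 leq_add2l.
have N10 : 1 <= N.+1%:R :> R by rewrite ler1n.
have t0 : 0 <= t by nra.
have half : 2^-1 <= t ^+ N.+1.*2.
  have hb : -1 <= t - 1 by rewrite lerBrDr addNr.
  have := @bernoulli_ineq R (t - 1) N.+1.*2 hb.
  rewrite [1 + (t - 1)]addrC subrK; apply: le_trans.
  by rewrite -mul2n natrM; lra.
have h1 := @tail_mass_le_moment R mu t N.+1.*2 t0.
have tm0 := tail_mass_ge0 mu t.
have h2 : tail_mass mu t <= 2 * moment mu N.+1.*2.
  rewrite -ler_pdivrMl//; apply: le_trans h1; exact: ler_wpM2r.
apply: le_trans h2 _.
have Ns : 0 < N.+1%:R `^ s :> R by rewrite powR_gt0.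
rewrite -(ler_pM2l Ns) mulrCA; apply: le_trans (ler_wpM2l _ hN0) _ => //.
rewrite [leRHS]mulrCA -powRM ?(ltW x0)//.
have E0 : 0 < 8 `^ s :> R by rewrite powR_gt0.
rewrite [leLHS](_ : _ = e * (8 `^ s)^-1); last by rewrite /e'; field; rewrite gt_eqF.
rewrite ler_wpM2l ?(ltW e0)// -(ler_pM2l E0) divff ?gt_eqF//.
rewrite -powRM ?mulr_ge0 ?(ltW x0)//.
rewrite [leLHS](_ : 1 = 1 `^ s); last by rewrite powR1.
by rewrite ge0_ler_powR ?nnegrE ?mulr_ge0 ?(ltW s0) ?(ltW x0).
Qed.

Lemma vanishing_carleson_of_tail : tail_little_o -> vanishing_carleson mu s.
Proof.
move=> h; split.
  have [d /andP[d0 d1] hd] := h 1 ltr01.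
  have m0 := tail_mass_ge0 mu 0.
  have c0 : 0 <= tail_mass mu 0 / d `^ s by rewrite divr_ge0 ?powR_ge0.
  (* For t < 1 - d the second summand absorbs the whole mass of [0, 1), because (1 - t)^s >= d^s. *)
  exists (1 + tail_mass mu 0 / d `^ s); first by rewrite ltr_pwDl.
  move=> t /andP[t0 t1].
  apply: (@le_trans _ _ (tail_mass mu t)%:E); first by rewrite -tail_massE.
  rewrite lee_fin.
  have [dt|td] := leP (1 - d) t.
    apply: le_trans (hd t _) _; first by rewrite dt.
    by rewrite ler_wpM2r ?powR_ge0// lerDl.
  apply: le_trans (tail_mass_le mu _ _ t0) _.
  apply: (@le_trans _ _ (tail_mass mu 0 / d `^ s * (1 - t) `^ s)); last first.
    by rewrite ler_wpM2r ?powR_ge0// lerDr.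
  rewrite -mulrA ler_peMr// ler_pdivlMl ?powR_gt0// mulr1.
  by rewrite ge0_ler_powR ?nnegrE ?(ltW s0) ?(ltW d0)//; lra.
apply/cvgrPdist_le => e e0; have [d /andP[d0 d1] hd] := h e e0.
near=> t.
have t1 : t < 1 by near: t; exact: nbhs_left_lt.
have dt : 1 - d <= t.
  by near: t; apply: nbhs_left_ge; rewrite ltrBlDr ltrDl.
have x0 : 0 < (1 - t) `^ s by rewrite powR_gt0// subr_gt0.
rewrite sub0r normrN ger0_norm ?divr_ge0 ?(ltW x0) ?tail_mass_ge0//.
by rewrite ler_pdivrMr// hd// dt.
Unshelve. all: by end_near.
Qed.

Lemma tail_of_vanishing_carleson : vanishing_carleson mu s -> tail_little_o.
Proof.
move=> [_ /cvgrPdist_le h] e e0.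
have [d /= d0 hd] := h e e0.
(* Half the radius makes the distance to 1 strictly smaller than [d], and the minimum with 1/2 keeps
   the witness below 1. *)
exists (Num.min (d / 2) 2^-1).
  rewrite lt_min divr_gt0//= invr_gt0 ltr0n/= gt_min; apply/orP; right.
  by rewrite invf_lt1// ltr1n.
move=> t /andP[dt t1].
have dm : Num.min (d / 2) 2^-1 < d by rewrite gt_min ltr_pdivrMr// ltr_pMr// ltr1n.
have x0 : 0 < (1 - t) `^ s by rewrite powR_gt0// subr_gt0.
have := hd t; rewrite /= ger0_norm ?subr_ge0 ?(ltW t1)//.
move=> /(_ _ t1); rewrite sub0r normrN ger0_norm ?divr_ge0 ?(ltW x0) ?tail_mass_ge0//.
rewrite ler_pdivrMr//; apply; lra.
Qed.

(** The tail bound near 1 is completed by K (1 - t)^3 elsewhere; this costs a multiple of (n +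
    1)^-3, negligible since s < 2. *)
Lemma moment_of_tail : tail_little_o -> moment_little_o.
Proof.
(* Here 416 = 52 * 2 * 4: the 52 of [moment_le_of_tail_mass], its two terms, and 2^s <= 4 in the
   passage from n + 1 to n + 2. *)
move=> h e e0; pose e' := e / 416; have e'0 : 0 < e' by rewrite divr_gt0 ?ltr0n.
have [d /andP[d0 d1] hd] := h _ e'0.
have m0 := tail_mass_ge0 mu 0.
pose K := tail_mass mu 0 / d ^+ 3.
have K0 : 0 <= K by rewrite divr_ge0// exprn_ge0// ltW.
have tail t : 0 <= t < 1 ->
    tail_mass mu t <= e' * (1 - t) `^ s + K * (1 - t) ^+ 3.
  move=> /andP[t0 t1]; have x0 : 0 <= 1 - t by rewrite subr_ge0 ltW.
  have [dt|td] := leP (1 - d) t.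
    apply: le_trans (hd t _) _; first by rewrite dt.
    by rewrite lerDl mulr_ge0 ?exprn_ge0.
  apply: le_trans (tail_mass_le mu _ _ t0) _.
  apply: ler_wpDl; first by apply: mulr_ge0; [exact: ltW|exact: powR_ge0].
  rewrite /K -mulrA ler_peMr// ler_pdivlMl ?exprn_gt0// mulr1.
  by rewrite lerXn2r ?nnegrE ?(ltW d0)//; lra.
move: K K0 tail => K K0 tail.
(* Beyond K / e' one has K (n + 1)^-3 <= e' (n + 1)^-2 <= e' (n + 1)^-s. *)
have [N _ hN] := @nbhs_infty_ger R (K / e').
exists N.+1 => -[//|n] Nn.
have s03 : 0 <= s <= 3 by rewrite (ltW s0)/=; apply: le_trans (ltW s2) _; rewrite ler_nat.
apply: le_trans (@moment_le_of_tail_mass _ mu s e' K n s03 (ltW e'0) K0 tail) _.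
have n0 : 0 < n.+1%:R :> R by rewrite ltr0n.
have Kn : K * n.+1%:R ^- 3 <= e' * n.+1%:R `^ (- s).
  apply: (@le_trans _ _ (K / n.+1%:R * n.+1%:R `^ (- 2))).
    by rewrite powRN powR_mulrn//= -mulrA -invfM -exprS.
  apply: ler_pM; rewrite ?powR_ge0 ?divr_ge0//.
    rewrite ler_pdivrMr// mulrC -ler_pdivrMr//.
    by apply: (hN n.+1) => /=; exact: ltnW.
  by rewrite ler_powR ?ler1n// lerN2 ltW.
have n2 : n.+1%:R `^ (- s) <= 4 * n.+2%:R `^ (- s) :> R.
  rewrite !powRN ler_pdivlMr ?powR_gt0// mulrC.
  rewrite ler_pdivrMr ?powR_gt0//.
  apply: (@le_trans _ _ ((2 * n.+1%:R) `^ s)).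
    rewrite ge0_ler_powR ?nnegrE ?(ltW s0)// -natrM ler_nat.
    by rewrite mul2n -addnn addSn ltnS leq_addl.
  rewrite powRM// ler_wpM2r ?powR_ge0//.
  rewrite (_ : 4 = 2 `^ 2); first by rewrite ler_powR ?ler1n// ltW.
  by rewrite powR_mulrn// -natrX.
apply: le_trans (ler_wpM2l _ (lerD (lexx _) Kn)) _ => //.
apply: (@le_trans _ _ (104 * e' * (4 * n.+2%:R `^ (- s)))).
  rewrite (_ : 52 * _ = 104 * e' * n.+1%:R `^ (- s)); last by ring.
  by rewrite ler_wpM2l// mulr_ge0 ?ler0n ?ltW.
by rewrite le_eqVlt; apply/orP; left; apply/eqP; rewrite /e'; field.
Qed.

End carleson_moments.

(** * Compactness of the Cesaro operator and decay of moments *)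

Section cesaro_operator.
Context {R : realType}.
Local Notation C := (R[i]^o).
Local Notation normc := ComplexField.Normc.normc.
Variables (alpha beta : R) (mu : {finite_measure set (measurableTypeR R) -> \bar R}).
Hypotheses (alpha0 : 0 < alpha) (alpha2 : alpha < 2).
Hypotheses (beta0 : 0 < beta) (beta2 : beta < 2).
Implicit Types a b : nat -> C.

Local Notation s := (1 + (alpha - beta) / 2).

Let s0 : 0 < s. Proof. by move: alpha0 beta2; lra. Qed.
Let s2 : s < 2. Proof. by move: beta0 alpha2; lra. Qed.

Lemma taylor_cesaro_dirichlet (f : dirichlet alpha) :
  taylor_coef (Defs.cesaro mu f) = cesaro_coef mu (taylor_coef f).
Proof.
apply: (@taylor_cesaro _ _ (moment mu 0)); first exact: moment_bounded.
by apply: (@dirichlet_poly_growth _ alpha) => //; exact: dirichlet_sum_lty.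
Qed.

(** The exponents match: (1 - beta) - 2 s = - 1 - alpha, the weight of [hardy_sum]. *)
Lemma dirichlet_term_cesaro_le e (n : nat) a : 0 <= e ->
  moment mu n <= e * n.+1%:R `^ (- s) ->
  dirichlet_term beta (cesaro_coef mu a) n <=
  e ^+ 2 * (n.+1%:R `^ (- 1 - alpha) * (\sum_(k < n.+1) normc (a k)) ^+ 2).
Proof.
move=> e0 h; rewrite /dirichlet_term /cesaro_coef.
rewrite ComplexField.Normc.normcM normc_real ger0_norm ?moment_ge0//.
have -> : n.+1%:R `^ (- 1 - alpha) =
    n.+1%:R `^ (1 - beta) * (n.+1%:R `^ (- s) * n.+1%:R `^ (- s)) :> R.
  rewrite -!powRD ?pnatr_eq0 ?implybT//; congr (_ `^ _).
  by field.
set S := normc _; set S' := \sum_(k < _) _.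
have SS' : S <= S' by exact: normc_sum_le.
have S0 : 0 <= S by exact: normc_ge0.
rewrite [leRHS](_ : _ = n.+1%:R `^ (1 - beta) * (e * n.+1%:R `^ (- s) * S') ^+ 2); last by ring.
rewrite ler_wpM2l ?powR_ge0// lerXn2r ?nnegrE ?mulr_ge0 ?moment_ge0 ?powR_ge0//.
  exact: le_trans SS'.
by rewrite ler_pM ?moment_ge0.
Qed.

(** Serves twice: N = 0 with a fixed e gives boundedness, large N with a small e gives the uniform
    tails. *)
Lemma cesaro_sum_le : exists2 c : R, 0 < c &
  forall e (N m : nat) a, 0 <= e ->
  (forall n, (N <= n)%N -> moment mu n <= e * n.+1%:R `^ (- s)) ->
  \sum_(N <= n < m) dirichlet_term beta (cesaro_coef mu a) n <=
  e ^+ 2 * (c * \sum_(n < m) dirichlet_term alpha a n).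
Proof.
have [c c0 hardy] := @hardy_sum R alpha alpha0; exists c => // e N m a e0 h.
apply: le_trans (ler_wpM2l (sqr_ge0 _) (hardy _ m (fun n => normc_ge0 (a n)))).
rewrite mulr_sumr big_geq_mkord [leRHS](bigID (fun n : 'I_m => (N <= n)%N)) /=.
rewrite ler_wpDr//.
  by apply: sumr_ge0 => n _; rewrite mulr_ge0 ?sqr_ge0// mulr_ge0 ?powR_ge0 ?sqr_ge0.
apply: ler_sum => n Nn; exact: dirichlet_term_cesaro_le (h n Nn).
Qed.

Lemma cesaro_compact_of_moment : moment_little_o s mu -> cesaro_compact mu alpha beta.
Proof.
move=> mo; have [c c0 hsum] := cesaro_sum_le.
have [B B0 mB] := moment_little_o_bounded s mu s0 mo.
have hfin (f : dirichlet alpha) :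
    (dirichlet_sum beta (cesaro_coef mu (taylor_coef f)) < +oo)%E.
  have /dirichlet_sum_ltyP[M hM] := dirichlet_sum_lty f.
  apply/dirichlet_sum_ltyP; exists (B ^+ 2 * (c * M)) => m.
  rewrite -(big_mkord xpredT).
  apply: le_trans (hsum B 0%N m _ B0 (fun n _ => mB n)) _.
  by rewrite ler_wpM2l ?sqr_ge0// ler_wpM2l// ltW.
have [T0 T0F T0E] : exists2 T0 : dirichlet alpha -> dirichlet beta,
    forall f, T0 f = Defs.cesaro mu f :> (C -> C) &
    forall f, taylor_coef (T0 f) = cesaro_coef mu (taylor_coef f).
  exists (fun f => dirichlet_of_coef beta (cesaro_coef mu (taylor_coef f))) => f.
    exact: dirichlet_of_coef_fun.
  exact: taylor_dirichlet_of_coef.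
have T0lin : linear T0.
  move=> k f g; apply: taylor_inj.
  rewrite T0E !dirichlet_taylorD cesaro_coefD.
  by rewrite (T0E f) (T0E g).
pose Tlin := GRing.isLinear.Build _ _ _ _ T0 T0lin.
pose T : {linear dirichlet alpha -> dirichlet beta} := HB.pack T0 Tlin.
exists T => //.
(* The condition 0 < e sits under the existential, so that choice yields a modulus on all of [R].
   The square root makes its square times [c] equal to e. *)
have tail (e : R) : exists N, 0 < e -> forall n, (N <= n)%N ->
    moment mu n <= Num.sqrt (e / c) * n.+1%:R `^ (- s).
  have [e0|] := ltP 0 e; last by exists 0%N.
  have d0 : 0 < Num.sqrt (e / c) by rewrite sqrtr_gt0 divr_gt0.
  by have [N hN] := mo _ d0; exists N.
have /choice[N hN] := tail.
have Kc := @uniform_tails_compact R beta N (B ^+ 2 * c) beta2.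
apply: (subclosed_compact _ Kc); first exact: closed_closure.
(* The compact set is closed, so it suffices to place the image of the unit ball itself inside
   it. *)
have cK := compact_closed (@norm_hausdorff _ _) Kc.
rewrite [X in _ `<=` X](proj1 (closure_id _) cK).
apply: closure_subset => _ [f /= f1 <-] /=.
have {}f1 : dirichlet_norm f <= 1.
  by move: f1; rewrite dirichlet_normE -[1 : R[i]]/((1 : R)%:C) lecR.
have f1' m : \sum_(n < m) dirichlet_term alpha (taylor_coef f) n <= 1.
  by have := proj1 (dirichlet_norm_leP _ f _ ler01) f1 m; rewrite expr1n.
rewrite T0E; split=> [m|e e0 m].
  apply: le_trans (hsum B 0%N m _ B0 (fun n _ => mB n)) _.
  by rewrite ler_wpM2l ?sqr_ge0// ler_piMr// ltW.
apply: le_trans (hsum _ _ _ _ (sqrtr_ge0 _) (hN e e0)) _.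
rewrite sqr_sqrtr ?divr_ge0 ?(ltW e0) ?(ltW c0)//.
by rewrite mulrA divfK ?gt_eqF// ler_piMr// ltW.
Qed.

(** The exponent 1 - beta may have either sign. If it is negative, compare with 2 (N + 1) and use
    2^(1 - beta) >= 1/2, from beta < 2. *)
Lemma dyadic_powR_ge (n N : nat) : (N.+1 <= n)%N -> (n < N.+1.*2)%N ->
  2^-1 * N.+1%:R `^ (1 - beta) <= n.+1%:R `^ (1 - beta).
Proof.
move=> Nn nN; have [b1|b1] := leP beta 1.
  apply: (@le_trans _ _ (N.+1%:R `^ (1 - beta))).
    by rewrite ler_piMl ?powR_ge0// invf_le1// ler1n.
  by rewrite ge0_ler_powR ?nnegrE ?subr_ge0// ler_nat ltnW.
apply: (@le_trans _ _ (N.+1.*2%:R `^ (1 - beta))).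
  rewrite -mul2n natrM powRM// ler_wpM2r ?powR_ge0//.
  rewrite -powR_inv1// ler_powR ?ler1n//; move: beta2; lra.
rewrite -(opprB beta 1) !powRN lef_pV2 ?posrE ?powR_gt0//.
by rewrite ge0_ler_powR ?nnegrE ?subr_ge0 ?(ltW b1)// ler_nat.
Qed.

Lemma cesaro_compact_moment : cesaro_compact mu alpha beta ->
  N.+1%:R `^ s * moment mu N.+1.*2 @[N --> \oo] --> (0 : R).
Proof.
move=> [T TF Tc].
have p0 : 0 < 2 - alpha by rewrite subr_gt0.
have [c c0 hc] := @sum_powR_le R (2 - alpha) p0.
(* Normalization: by [hc], the polynomial q_N (1 + z + .. + z^N) has norm at most 1. *)
pose q (N : nat) : R := Num.sqrt c^-1 * N.+1%:R `^ (- ((2 - alpha) / 2)).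
have q0 N : 0 <= q N by rewrite mulr_ge0 ?sqrtr_ge0 ?powR_ge0.
have q2 N : q N ^+ 2 = c^-1 * N.+1%:R `^ (- (2 - alpha)).
  rewrite exprMn sqr_sqrtr ?invr_ge0 ?(ltW c0)// expr2.
  by rewrite -powRD ?pnatr_eq0 ?implybT// -opprD -splitr.
have qcvg : q N @[N --> \oo] --> (0 : R).
  rewrite -(mulr0 (Num.sqrt c^-1)); apply: cvgMl_tmp; apply: powRN_cvg0.
  by rewrite divr_gt0.
pose a N : nat -> C := fun k => if (k < N.+1)%N then (q N)%:C else 0.
have an N k : normc (a N k) <= q N.
  by rewrite /a; case: ifP => _; rewrite ?normc_real ?ger0_norm ?ComplexField.Normc.normc0.
have asum N m : \sum_(k < m) dirichlet_term alpha (a N) k <= 1.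
  apply: le_trans (@sum_split_le _ _ N.+1 m (@dirichlet_term_ge0 _ alpha (a N))) _.
  rewrite [X in _ + X]big_nat_cond [X in _ + X]big1 ?addr0; last first.
    move=> k /andP[/andP[Nk _] _]; rewrite /dirichlet_term /a ltnNge Nk.
    by rewrite ComplexField.Normc.normc0 expr0n mulr0.
  rewrite big_mkord.
  apply: (@le_trans _ _ (\sum_(k < N.+1) k.+1%:R `^ (2 - alpha - 1) * q N ^+ 2)).
    apply: ler_sum => k _; rewrite /dirichlet_term.
    rewrite (_ : 2 - alpha - 1 = 1 - alpha); last by ring.
    by rewrite ler_wpM2l ?powR_ge0// lerXn2r ?nnegrE ?normc_ge0.
  rewrite -mulr_suml; apply: le_trans (ler_wpM2r (sqr_ge0 _) (hc _)) _.
  rewrite q2 powRN le_eqVlt; apply/orP; left; apply/eqP.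
  by field; rewrite gt_eqF ?powR_gt0//= gt_eqF.
pose f N := dirichlet_of_coef alpha (a N).
have tf N : taylor_coef (f N) = a N.
  apply: taylor_dirichlet_of_coef => //.
  by apply/dirichlet_sum_ltyP; exists 1; exact: asum.
have f1 N : dirichlet_norm (f N) <= 1.
  by apply: (proj2 (dirichlet_norm_leP _ _ _ ler01)) => m; rewrite tf expr1n.
have tT N : taylor_coef (T (f N)) = cesaro_coef mu (a N).
  by rewrite TF taylor_cesaro_dirichlet// tf.
have m00 := moment_ge0 mu 0.
(* Only the first n + 1 terms of [a N] enter, each of modulus at most q_N, and q_N tends to 0. *)
have Tcoef n : normc (taylor_coef (T (f N)) n) @[N --> \oo] --> (0 : R).
  apply: (@squeeze_cvgr _ _ _ _ (fun=> 0) (fun N => moment mu 0 * n.+1%:R * q N)).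
  - apply: nearW => N; rewrite normc_ge0 tT /cesaro_coef.
    rewrite ComplexField.Normc.normcM normc_real -mulrA.
    apply: ler_pM; rewrite ?normc_ge0 ?moment_bounded//.
    apply: le_trans (normc_sum_le _ _ _ _) _.
    apply: (@le_trans _ _ (\sum_(k < n.+1) q N)); first exact: ler_sum.
    by rewrite sumr_const card_ord mulr_natl.
  - exact: cvg_cst.
  - by rewrite -(mulr0 (moment mu 0 * n.+1%:R)); exact: cvgMl_tmp.
have Tcvg := @compact_operator_weak_null R alpha beta T f Tc f1 Tcoef.
(* The factor 2 c undoes the 1/2 of [dyadic_powR_ge] and the c^-1 in q_N^2. *)
apply: (@squeeze_cvgr _ _ _ _ (fun=> 0)
  (fun N => Num.sqrt (2 * c) * dirichlet_norm (T (f N)))); last 2 first.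
- exact: cvg_cst.
- by rewrite -(mulr0 (Num.sqrt (2 * c))); exact: cvgMl_tmp.
apply: nearW => N; rewrite mulr_ge0 ?powR_ge0 ?moment_ge0//=.
have c20 : 0 <= 2 * c by rewrite mulr_ge0// ltW.
have D0 : 0 <= dirichlet_norm (T (f N)) by exact: sqrtr_ge0.
rewrite -(@ler_pXn2r _ 2) ?nnegrE ?mulr_ge0 ?powR_ge0 ?moment_ge0 ?sqrtr_ge0//.
rewrite [leRHS]exprMn sqr_sqrtr// -ler_pdivrMl ?mulr_gt0//.
have := proj1 (dirichlet_norm_leP _ (T (f N)) _ D0) (lexx _) N.+1.*2.
rewrite tT; apply: le_trans.
rewrite -(big_mkord xpredT) (@big_cat_nat _ _ _ N.+1) //=; last first.
  by rewrite -addnn leq_addr.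
rewrite ler_wpDl//; first by apply: sumr_ge0 => k _; exact: dirichlet_term_ge0.
(* On the block N + 1 <= n < 2 (N + 1) the partial sum is (N + 1) q_N and mu[n] >= mu[2 (N + 1)], so
   [L] bounds each of the N + 1 terms from below. *)
pose L : R := 2^-1 * N.+1%:R `^ (1 - beta) * (moment mu N.+1.*2 * (N.+1%:R * q N)) ^+ 2.
apply: (@le_trans _ _ (\sum_(N.+1 <= n < N.+1.*2) L)).
  rewrite sumr_const_nat (_ : (N.+1.*2 - N.+1)%N = N.+1); last first.
    by rewrite -addnn addnK.
  have -> : L = 2^-1 * N.+1%:R `^ (1 - beta) *
      (moment mu N.+1.*2 ^+ 2 * N.+1%:R ^+ 2 * q N ^+ 2) by rewrite /L; ring.
  rewrite q2 -[leRHS]mulr_natl.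
  rewrite le_eqVlt; apply/orP; left; apply/eqP.
  (* Here 1 - beta = 2 s + (2 - alpha) - 3, and the - 3 cancels the factor (N + 1)^2 of [L] and the
     number N + 1 of terms. *)
  have -> : N.+1%:R `^ (1 - beta) = N.+1%:R `^ s * N.+1%:R `^ s *
      N.+1%:R `^ (2 - alpha) * N.+1%:R ^- 3 :> R.
    rewrite -powR_mulrn// -powRN -!powRD ?pnatr_eq0 ?implybT//.
    by congr (_ `^ _); field.
  rewrite [N.+1%:R `^ (- (2 - alpha))]powRN.
  have : 0 < N.+1%:R `^ (2 - alpha) :> R by rewrite powR_gt0.
  have : 0 < N.+1%:R :> R by [].
  move: (N.+1%:R `^ s) (N.+1%:R `^ (2 - alpha)) (moment mu _) => u v w.
  move: (N.+1%:R : R) => x x0 v0.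
  by field; rewrite !gt_eqF.
apply: ler_sum_nat => n /andP[Nn nN].
rewrite /L /dirichlet_term ler_pM ?sqr_ge0 ?dyadic_powR_ge ?mulr_ge0 ?powR_ge0//.
rewrite lerXn2r ?nnegrE ?normc_ge0 ?mulr_ge0 ?moment_ge0//.
rewrite /cesaro_coef ComplexField.Normc.normcM normc_real ger0_norm ?moment_ge0//.
rewrite ler_pM ?moment_ge0 ?mulr_ge0 ?moment_le ?(ltnW nN)//.
have -> : \sum_(k < n.+1) a N k = (N.+1%:R * q N)%:C.
  rewrite -(big_mkord xpredT) (@big_cat_nat _ _ _ N.+1) ?(leqW Nn)//=.
  rewrite [X in _ + X]big_nat_cond [X in _ + X]big1 ?addr0; last first.
    by move=> k /andP[/andP[Nk _] _]; rewrite /a ltnNge Nk.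
  rewrite big_nat_cond (eq_bigr (fun=> (q N)%:C)); last first.
    by move=> k /andP[/andP[_ kN] _]; rewrite /a kN.
  by rewrite -big_nat_cond sumr_const_nat subn0 [in RHS]mulr_natl raddfMn.
by rewrite normc_real ger0_norm// mulr_ge0.
Qed.

End cesaro_operator.

Local Close Scope complex_scope.

Theorem theorem3p1 (R : realType) (alpha beta : R)
    (mu : {finite_measure set (measurableTypeR R) -> \bar R})
    (alpha_bounds : 0 < alpha < 2) (beta_bounds : 0 < beta < 2)
    (mu_supp : mu (~` `[0, 1[%classic) = 0%E) :
  [<-> cesaro_compact mu alpha beta;
       vanishing_carleson mu (1 + (alpha - beta) / 2);
       moment mu =o_\oo (fun n => n.+1%:R `^ (- 1 - (alpha - beta) / 2))].
Proof.
have /andP[alpha0 alpha2] := alpha_bounds; have /andP[beta0 beta2] := beta_bounds.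
have s0 : 0 < 1 + (alpha - beta) / 2 by lra.
have s2 : 1 + (alpha - beta) / 2 < 2 by lra.
have exponent : - 1 - (alpha - beta) / 2 = - (1 + (alpha - beta) / 2) by ring.
have powRge0 n : 0 <= n.+1%:R `^ (- (1 + (alpha - beta) / 2)) by exact: powR_ge0.
tfae; rewrite ?exponent.
(* The moments of index 2 (N + 1) are enough to control all tails. *)
- move=> Tc; apply: vanishing_carleson_of_tail => //; apply: tail_of_moment => //.
  exact: cesaro_compact_moment.
- move=> /tail_of_vanishing_carleson h; apply/eqoP => e e0.
  have [N hN] := moment_of_tail _ _ s0 s2 h _ e0.
  by exists N => // n Nn; rewrite ger0_norm ?moment_ge0// ger0_norm// hN.
- move=> /eqoP mo; apply: cesaro_compact_of_moment => // e e0.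
  have [N _ hN] := mo _ e0; exists N => n Nn.
  by have := hN n Nn; rewrite /= ger0_norm ?moment_ge0// ger0_norm.
Qed.
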